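(* Let $\mathcal A\subset\mathbb R^d$ be a point configuration. Every weight function $w:\mathcal A\to\mathbb R$ has a coherent decomposition $$w=w_0+\sum_{S^p\text{ a 1-split of }\mathcal A}\lambda_p w_p+\sum_{S\text{ a 2-split of }\mathcal A}\lambda_S w_S$$ with all $\lambda_p,\lambda_S\ge0$ and $w_0$ split prime, and this decomposition is unique among all coherent decompositions of $w$ into (nonnegative multiples of) the weight functions of $1$-splits and $2$-splits and a split prime weight function.
   Context: A point configuration is a finite multiset $\mathcal A\subset\mathbb R^d$ with affine hull $\mathbb R^d$. Subdivisions of $\mathcal A$: collections of subconfigurations closed under faces, whose convex hulls cover $\operatorname{conv}\mathcal A$ with pairwise disjoint relative interiors; $\Sigma'$ coarsens $\Sigma$ if each face of $\Sigma$ lies in a face of $\Sigma'$; coarsest = non-trivial and coarsened only by itself and the trivial subdivision (all faces of $\mathcal A$). For $w:\mathcal A\to\mathbb R$, $\Sigma_w(\mathcal A)$ is the regular subdivision given by the lower faces of $\operatorname{conv}\{(w(a),a)\}+\mathbb R_{\ge0}(1,0,\dots,0)$, and $\mathcal E_w(\mathcal A)=\{x\in\mathbb R\times\mathbb R^d:\langle(1,a),x\rangle\ge-w(a)\ \forall a\}$. A decomposition $w=\sum_i w_i$ is coherent if $\sum_i\mathcal E_{w_i}(\mathcal A)=\mathcal E_w(\mathcal A)$ (Minkowski sum). For an element $p\in\mathcal A$ with $p\in\operatorname{conv}(\mathcal A\setminus\{p\})$, the $1$-split $S^p$ is the subdivision with unique maximal face $\mathcal A\setminus\{p\}$, and $w_p$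 is the weight with $w_p(p)=1$ and $w_p=0$ on all other elements. A $2$-split is a coarsest subdivision with exactly two maximal faces; it is induced by a hyperplane $H_S=\{x:\langle\alpha,x\rangle=\beta\}$, and its weight function is $w_S(a)=|\langle\alpha,a\rangle-\beta|$. A weight function $w$ is split prime if $\Sigma_w(\mathcal A)$ does not refine any $1$-split or $2$-split of $\mathcal A$. *)

(* Defs.v *)
From HB Require Import structures.
From mathcomp Require Import all_boot all_order all_algebra.
From mathcomp Require Import all_classical all_reals topology normedtype.

Set Implicit Arguments.
Unset Strict Implicit.
Unset Printing Implicit Defensive.

Import Order.TTheory GRing.Theory Num.Theory.
Import numFieldNormedType.Exports.

Local Open Scope classical_set_scope.
Local Open Scope ring_scope.

Section Convexity.
Variables (R : realType) (n : nat).
Implicit Types (X Y : set 'rV[R]_n) (x y c : 'rV[R]_n).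

Definition dotv x y : R := \sum_k x 0 k * y 0 k.

Definition affine_hull X : set 'rV[R]_n :=
  [set x | exists (m : nat) (y : 'I_m -> 'rV[R]_n) (t : 'I_m -> R),
     [/\ forall k, X (y k), \sum_k t k = 1 & x = \sum_k t k *: y k]].

Definition convex_hull X : set 'rV[R]_n :=
  [set x | exists (m : nat) (y : 'I_m -> 'rV[R]_n) (t : 'I_m -> R),
     [/\ forall k, X (y k), forall k, 0 <= t k, \sum_k t k = 1
       & x = \sum_k t k *: y k]].

(* interior of X in the subspace topology of its affine hull *)
Definition relint X : set 'rV[R]_n :=
  [set x | X x /\ \forall y \near within (affine_hull X) (nbhs x), X y].

Definition minkowski_sum X Y : set 'rV[R]_n := [set x + y | x in X & y in Y].

End Convexity.

(* A point configuration (a finite multiset of points of R^d) is a family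
   a : I -> 'rV[R]_d indexed by a finite type I of labels, so that repeated
   points keep distinct labels; a subconfiguration is a set F : {set I} of
   labels, and a collection of subconfigurations is a {set {set I}}. *)
Section PointConfiguration.
Variables (R : realType) (d : nat) (I : finType) (a : I -> 'rV[R]_d).
Implicit Types (F G : {set I}) (S T : {set {set I}}) (p : I) (w v : I -> R).

Definition is_point_configuration : Prop := affine_hull (range a) = [set: 'rV[R]_d].

Definition conv F : set 'rV[R]_d := convex_hull (a @` [set` F]).

(* G consists of the points of F lying on a face of conv F.  As usual for
   polytopes, the empty set and F itself are faces of F. *)
Definition is_face F G : Prop :=
  exists (c : 'rV[R]_d) (g : R),
    (forall i, i \in F -> g <= dotv c (a i)) /\
    G = [set i in F | dotv c (a i) == g]%SET.

Definition faces F : {set {set I}} := [set G | `[< is_face F G >]]%SET.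

Definition is_subdivision S : Prop :=
  [/\ forall F G, F \in S -> is_face F G -> G \in S,
      \bigcup_(F in [set` S]) conv F = conv [set: I]%SET
    & forall F G, F \in S -> G \in S -> F != G ->
        relint (conv F) `&` relint (conv G) = set0].

(* T coarsens S, i.e. S refines T *)
Definition coarsens T S : Prop :=
  forall F, F \in S -> exists2 G, G \in T & F \subset G.

Definition trivial_subdivision : {set {set I}} := faces [set: I]%SET.

Definition is_coarsest S : Prop :=
  [/\ is_subdivision S, S <> trivial_subdivision
    & forall T, is_subdivision T -> coarsens T S ->
        T = S \/ T = trivial_subdivision].

Definition maximal_faces S : {set {set I}} :=
  [set F in S | [forall G in S, (F \subset G) ==> (G == F)]]%SET.

(* The ambient space R x R^d is 'rV[R]_(1 + d), with (r, x) = row_mx r%:M x. *)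

(* conv {(w(a), a)} + R_{>=0} (1, 0, ..., 0) *)
Definition lifted_polyhedron w : set 'rV[R]_(1 + d) :=
  minkowski_sum
    (convex_hull (range (fun i => row_mx (w i)%:M (a i))))
    [set row_mx r%:M 0 | r in [set r : R | 0 <= r]].

(* lower faces are those with an inner normal (c0, c) such that c0 > 0 *)
Definition is_lower_face (P Q : set 'rV[R]_(1 + d)) : Prop :=
  exists (c0 : R) (c : 'rV[R]_d) (g : R),
    [/\ 0 < c0,
        P `<=` [set z | g <= dotv (row_mx c0%:M c) z]
      & Q = P `&` [set z | dotv (row_mx c0%:M c) z = g]].

Definition regular_subdivision w : {set {set I}} :=
  [set F : {set I} | `[< exists Q, is_lower_face (lifted_polyhedron w) Q /\
     forall i, i \in F <-> Q (row_mx (w i)%:M (a i)) >]]%SET.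

Definition envelope w : set 'rV[R]_(1 + d) :=
  [set x | forall i, - w i <= dotv (row_mx 1%:M (a i)) x].

Definition is_coherent_decomposition w (vs : seq (I -> R)) : Prop :=
  (forall i, w i = \sum_(v <- vs) v i) /\
  \big[@minkowski_sum R (1 + d)/[set 0]]_(v <- vs) envelope v = envelope w.

Definition is_1split_point p : Prop := conv [set~ p]%SET (a p).

Definition split1 p : {set {set I}} := faces [set~ p]%SET.

Definition weight1 p : I -> R := fun i => (i == p)%:R.

Definition is_2split S : Prop := is_coarsest S /\ #|maximal_faces S| = 2%N.

(* the pair h = (alpha, beta) stands for the hyperplane
   {x | <alpha, x> = beta} *)
Definition induces_2split (h : 'rV[R]_d * R) S : Prop :=
  h.1 != 0 /\
  maximal_faces S = [set [set i | h.2 <= dotv h.1 (a i)];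
                         [set i | dotv h.1 (a i) <= h.2]]%SET.

(* The equation (alpha, beta) of H_S, hence also w_S, is determined by S only
   up to a scalar factor: h picks one such equation for each 2-split.  The
   existence premise makes this satisfiable for every configuration. *)
Definition is_equation_choice (h : {set {set I}} -> 'rV[R]_d * R) : Prop :=
  forall S, is_2split S ->
    (exists k, induces_2split k S) -> induces_2split (h S) S.

Definition weight2 (h : 'rV[R]_d * R) : I -> R :=
  fun i => `|dotv h.1 (a i) - h.2|.

Definition split_prime w : Prop :=
  (forall p, is_1split_point p -> ~ coarsens (split1 p) (regular_subdivision w)) /\
  (forall S, is_2split S -> ~ coarsens S (regular_subdivision w)).

Definition all_1splits : {set I} := [set p | `[< is_1split_point p >]]%SET.

Definition all_2splits : {set {set {set I}}} := [set S | `[< is_2split S >]]%SET.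

(* w = w0 + sum_p l1(p) w_p + sum_S l2(S) w_S, the sums running over all
   1-splits S^p and all 2-splits S *)
Definition is_split_decomposition (h : {set {set I}} -> 'rV[R]_d * R) w
    (w0 : I -> R) (l1 : I -> R) (l2 : {set {set I}} -> R) : Prop :=
  [/\ forall p, p \in all_1splits -> 0 <= l1 p,
      forall S, S \in all_2splits -> 0 <= l2 S,
      split_prime w0
    & is_coherent_decomposition w
        (w0 :: [seq (fun i => l1 p * weight1 p i) | p <- enum all_1splits]
            ++ [seq (fun i => l2 T * weight2 (h T) i) | T <- enum all_2splits])].

End PointConfiguration.

(* Main.v *)
(** A point x of the envelope of w is an affine function lying below w, and
    its slack at a point k of the configuration is w(k) minus its value there;
    the cells of the regular subdivision are the zero sets of the slacks.

    Refining a split is positivity of finitely many linear forms in the slacks: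
    the slack at p for the 1-split at p, and h(i) slack(j) + |h(j)| slack(i) for
    points i, j strictly on opposite sides of the hyperplane h = 0 of a 2-split.
    The minimum over the envelope of these forms, divided by their value on the
    weight of the split, is the largest multiple of this weight which can be
    subtracted coherently; what remains no longer refines the split.  Doing this
    for one split after the other yields the decomposition.

    For uniqueness, suppose that a split s has a larger coefficient in a second
    decomposition.  Then w minus its first multiple of s still refines s, and
    removing the other splits t one at a time preserves this: in a
    full-dimensional cell crossing s, moving the affine function slightly would
    violate the lower bound on the forms of t, unless the hyperplanes of s and t
    agree.  Hence the first split prime part refines s, a contradiction.

    That a 2-split is given by a hyperplane follows from Stiemke's lemma applied
    to its two maximal faces F and G: the two sides of a separating hyperplane
    induce a subdivision coarsening the split, hence equal to it. *)

Require Import Defs.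
From mathcomp Require Import all_boot all_order all_algebra.
From mathcomp Require Import all_classical all_reals topology normedtype.
From mathcomp Require Import ring lra.

Set Implicit Arguments.
Unset Strict Implicit.
Unset Printing Implicit Defensive.

Import Order.TTheory GRing.Theory Num.Theory.
Import numFieldNormedType.Exports.

Local Open Scope classical_set_scope.
Local Open Scope ring_scope.

(** * Bilinearity of the dot product *)

Section DotProduct.
Variables (R : realType) (n : nat).
Implicit Types x y z : 'rV[R]_n.

Lemma dotvC x y : dotv x y = dotv y x.
Proof. by apply: eq_bigr => k _; rewrite mulrC. Qed.

Lemma dotvDr x y z : dotv x (y + z) = dotv x y + dotv x z.
Proof. by rewrite -big_split; apply: eq_bigr => k _; rewrite mxE mulrDr. Qed.

Lemma dotvZr x c y : dotv x (c *: y) = c * dotv x y.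
Proof. by rewrite mulr_sumr; apply: eq_bigr => k _; rewrite mxE mulrCA. Qed.

Lemma dotv0r x : dotv x 0 = 0.
Proof. by rewrite -(scale0r 0) dotvZr mul0r. Qed.

Lemma dotvDl x y z : dotv (x + y) z = dotv x z + dotv y z.
Proof. by rewrite dotvC dotvDr !(dotvC z). Qed.

Lemma dotvZl c x y : dotv (c *: x) y = c * dotv x y.
Proof. by rewrite dotvC dotvZr dotvC. Qed.

Lemma dotvNl x y : dotv (- x) y = - dotv x y.
Proof. by rewrite -scaleN1r dotvZl mulN1r. Qed.

Lemma dotvNr x y : dotv x (- y) = - dotv x y.
Proof. by rewrite dotvC dotvNl dotvC. Qed.

Lemma dotv0l x : dotv 0 x = 0 :> R.
Proof. by rewrite dotvC dotv0r. Qed.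

Lemma dotv_sumr (J : Type) (r : seq J) (P : pred J) x (F : J -> 'rV[R]_n) :
  dotv x (\sum_(j <- r | P j) F j) = \sum_(j <- r | P j) dotv x (F j).
Proof. exact: (big_morph (dotv x) (dotvDr x) (dotv0r x)). Qed.

Lemma dotv_delta x k : dotv x (delta_mx 0 k) = x 0 k.
Proof.
rewrite /dotv (bigD1 k) //= mxE !eqxx mulr1 big1 ?addr0 // => j jk.
by rewrite mxE (negbTE jk) andbF mulr0.
Qed.

End DotProduct.

Lemma dotv_row_mx (R : realType) (d : nat) (s t : R) (x y : 'rV[R]_d) :
  dotv (row_mx s%:M x) (row_mx t%:M y) = s * t + dotv x y.
Proof.
rewrite /dotv big_split_ord /= big_ord1 !row_mxEl !mxE !eqxx; congr (_ + _).
by apply: eq_bigr => k _; rewrite !row_mxEr.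
Qed.

Lemma row_mx_surj (R : realType) (d : nat) (x : 'rV[R]_(1 + d)) :
  exists (s : R) (c : 'rV[R]_d), x = row_mx s%:M c.
Proof.
exists (lsubmx x 0 0), (rsubmx x); rewrite -[LHS]hsubmxK; congr row_mx.
by apply/matrixP=> i j; rewrite !ord1 [RHS]mxE.
Qed.

(** * Envelopes, slacks and vertices *)

Section Envelope.
Variables (R : realType) (d : nat) (I : finType) (a : I -> 'rV[R]_d).
Implicit Types (w u v : I -> R) (x y z : 'rV[R]_(1 + d)) (i k : I).

(** A point [x] acts as an affine function whose constant term is its first coordinate. Since the
    envelope demands [- w k <= ev x k], the affine function below [w] is the negative of [ev x];
    hence the plus sign in [slack]. *)
Definition ev x k : R := dotv (row_mx 1%:M (a k)) x.
Definition slack w x k : R := w k + ev x k.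

Lemma evD x y k : ev (x + y) k = ev x k + ev y k. Proof. exact: dotvDr. Qed.
Lemma evZ c x k : ev (c *: x) k = c * ev x k. Proof. exact: dotvZr. Qed.
Lemma ev0 k : ev 0 k = 0. Proof. exact: dotv0r. Qed.
Lemma evN x k : ev (- x) k = - ev x k. Proof. by rewrite -scaleN1r evZ mulN1r. Qed.
Lemma ev_sum (J : Type) (r : seq J) (P : pred J) (F : J -> 'rV[R]_(1 + d)) k :
  ev (\sum_(j <- r | P j) F j) k = \sum_(j <- r | P j) ev (F j) k.
Proof. exact: dotv_sumr. Qed.
Lemma ev_row s (c : 'rV[R]_d) k : ev (row_mx s%:M c) k = s + dotv c (a k).
Proof. by rewrite /ev dotv_row_mx mul1r dotvC. Qed.

Lemma envelopeP w x : envelope a w x <-> forall k, 0 <= slack w x k.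
Proof.
by split=> E k; have := E k; rewrite /slack -/(ev x k) -lerBlDl sub0r.
Qed.

Lemma envelope_neq0 w : exists x, envelope a w x.
Proof.
exists (row_mx (\sum_k `|w k|)%:M 0); apply/envelopeP => k.
rewrite /slack ev_row dotvC dotv0r addr0 (bigD1 k) //= addrA.
apply: addr_ge0; last by apply: sumr_ge0.
by rewrite -lerBlDl sub0r -normrN ler_norm.
Qed.

Lemma envelopeD u v x y :
  envelope a u x -> envelope a v y -> envelope a (fun k => u k + v k) (x + y).
Proof.
move=> /envelopeP Eu /envelopeP Ev; apply/envelopeP => k.
by rewrite /slack evD addrACA addr_ge0 //; [apply: Eu|apply: Ev].
Qed.

(* For x in the envelope this says that x is a vertex of it. *)
Definition spanning w x :=
  forall y, (forall k, slack w x k = 0 -> ev y k = 0) -> y = 0.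

(** This leaves at most one vertex for each set of tight points, hence only finitely many to compare
    in [pair_form_min]. *)
Lemma spanning_uniq w x y :
  spanning w x -> (forall k, slack w x k = 0 -> slack w y k = 0) -> x = y.
Proof.
move=> sx xy; apply/esym/eqP; rewrite -subr_eq0; apply/eqP; apply: sx => k x0.
have := xy k x0; move: x0; rewrite /slack evD evN => x0 y0; lra.
Qed.

Hypothesis ha : is_point_configuration a.

(** An affine function vanishing on the configuration vanishes on its affine hull, which is the
    whole space. *)
Lemma ev_eq0 x : (forall k, ev x k = 0) -> x = 0.
Proof.
have [s [c ->]] := row_mx_surj x => x0.
have xy0 (y : 'rV[R]_d) : s + dotv c y = 0.
  have : affine_hull (range a) y by rewrite ha.
  case=> m [z [t [az t1 ->]]].
  rewrite dotv_sumr -[s]mulr1 -t1 mulr_sumr -big_split /= big1 // => k _.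
  have [i _ <-] := az k.
  by rewrite dotvZr [s * _]mulrC -mulrDr -ev_row x0 mulr0.
have s0 : s = 0 by rewrite -(xy0 0) dotv0r addr0.
have -> : c = 0.
  by apply/rowP => k; rewrite -dotv_delta mxE -(xy0 (delta_mx 0 k)) s0 add0r.
by rewrite s0 -scalemx1 scale0r row_mx0.
Qed.

(** The ratio test of the simplex method: along [y], the first decreasing slack to vanish determines
    the step length. *)
Lemma envelope_ray w x y : envelope a w x ->
    (forall k, slack w x k = 0 -> ev y k = 0) -> (exists k, ev y k < 0) ->
  exists t, [/\ 0 <= t, envelope a w (x + t *: y)
    & exists2 k, slack w x k != 0 & slack w (x + t *: y) k = 0].
Proof.
move=> /envelopeP Ex tight [k0 k0lt].
pose F k := slack w x k / - ev y k.
have [k klt kmin] := @arg_minP _ _ _ k0 (fun k => ev y k < 0) F k0lt.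
have slackt t i : slack w (x + t *: y) i = slack w x i + t * ev y i.
  by rewrite /slack evD evZ addrA.
exists (F k); split.
- by rewrite divr_ge0 // oppr_ge0 ltW.
- apply/envelopeP => i; rewrite slackt.
  have [ige|ilt] := leP 0 (ev y i).
    by rewrite addr_ge0 // mulr_ge0 // divr_ge0 // oppr_ge0 ltW.
  have := kmin i ilt; rewrite [X in _ <= X]/F ler_pdivlMr ?oppr_gt0 // mulrN => h.
  by rewrite -lerBlDr sub0r.
- exists k; first by apply: contraTneq klt => /tight ->; rewrite ltxx.
  by rewrite slackt /F invrN mulrN mulNr divfK ?subrr // lt_eqF.
Qed.

Definition pair_form (c : R * R) (ij : I * I) (s : I -> R) : R :=
  c.1 * s ij.1 + c.2 * s ij.2.

Lemma pair_formD c ij (s t : I -> R) :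
  pair_form c ij (fun k => s k + t k) = pair_form c ij s + pair_form c ij t.
Proof. by rewrite /pair_form; ring. Qed.

Lemma pair_formZ c ij r (s : I -> R) :
  pair_form c ij (fun k => r * s k) = r * pair_form c ij s.
Proof. by rewrite /pair_form; ring. Qed.

Lemma pair_form_ge0 c ij (s : I -> R) :
  0 <= c.1 -> 0 <= c.2 -> (forall k, 0 <= s k) -> 0 <= pair_form c ij s.
Proof. by move=> c1 c2 s0; rewrite addr_ge0 // mulr_ge0. Qed.

Lemma pair_form_slackD c ij u v x y :
  pair_form c ij (slack (fun k => u k + v k) (x + y)) =
  pair_form c ij (slack u x) + pair_form c ij (slack v y).
Proof. by rewrite /pair_form /slack !evD; ring. Qed.

(** As long as [x] is not a vertex, some direction fixes the tight slacks, does not increase the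
    form and decreases some slack. Following it makes a new point tight, so the number of nonzero
    slacks drops. *)
Lemma descend_to_vertex w x c ij :
    0 <= c.1 -> 0 <= c.2 -> envelope a w x ->
  exists y, [/\ envelope a w y, spanning w y,
    forall k, slack w x k = 0 -> slack w y k = 0
    & pair_form c ij (slack w y) <= pair_form c ij (slack w x)].
Proof.
move=> c1 c2.
have [m] := ubnP #|[set k | slack w x k != 0]|%SET.
elim: m x => // m IHm x; rewrite ltnS => lem Ex.
have [sx|nsx] := pselect (spanning w x); first by exists x; split.
have [y ty y0] : exists2 y, (forall k, slack w x k = 0 -> ev y k = 0) & y <> 0.
  apply: contrapT => ny; apply: nsx => y ty; apply: contrapT => y0.
  by apply: ny; exists y.
have [z [tz zneg zle]] : exists z, [/\ forall k, slack w x k = 0 -> ev z k = 0,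
    exists k, ev z k < 0 & pair_form c ij (ev z) <= 0].
  wlog yle : y ty y0 / pair_form c ij (ev y) <= 0.
    move=> th; have [|/ltW yge] := leP (pair_form c ij (ev y)) 0; first exact: th.
    apply: (th (- y)).
    - by move=> k /ty; rewrite evN => ->; rewrite oppr0.
    - by move/eqP; rewrite oppr_eq0 => /eqP.
    - move: yge; rewrite /pair_form !evN; lra.
  have [yneg|ypos] := pselect (exists k, ev y k < 0); first by exists y.
  (* If no slack decreases along [y], the form of [y] is nonnegative, so [- y] does not increase the
     form; some slack decreases along [- y] because [y] is nonzero. *)
  have {}ypos k : 0 <= ev y k.
    by rewrite leNgt; apply/negP => yk; apply: ypos; exists k.
  exists (- y); split; first by move=> k /ty; rewrite evN => ->; rewrite oppr0.
    apply: contrapT => nneg; apply: y0; apply: ev_eq0 => k.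
    apply/le_anti; rewrite ypos andbT leNgt; apply/negP => yk; apply: nneg.
    by exists k; rewrite evN oppr_lt0.
  have := pair_form_ge0 ij c1 c2 ypos; rewrite /pair_form !evN; lra.
have [t [t0 Et [k xk tk]]] := envelope_ray Ex tz zneg.
have keep i : slack w x i = 0 -> slack w (x + t *: z) i = 0.
  by move=> xi; move: (xi); rewrite /slack evD evZ (tz _ xi) mulr0 addr0.
have [|y' [Ey sy ky fy]] := IHm (x + t *: z) _ Et.
  apply: leq_trans lem; apply: proper_card; apply/properP; split.
    by apply/fintype.subsetP => i; rewrite !inE; apply: contraNN => /eqP/keep ->.
  by exists k; rewrite !inE ?tk ?eqxx.
exists y'; split=> // [i /keep /ky //|]; apply: le_trans fy _.
have -> : pair_form c ij (slack w (x + t *: z)) =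
    pair_form c ij (slack w x) + t * pair_form c ij (ev z).
  by rewrite /pair_form /slack !evD !evZ; ring.
by rewrite gerDl mulr_ge0_le0.
Qed.

(** Every value of the form is bounded below by its value at some vertex, and there are finitely
    many vertices. *)
Lemma pair_form_min w c ij : 0 <= c.1 -> 0 <= c.2 ->
  exists2 x, envelope a w x & forall y, envelope a w y ->
    pair_form c ij (slack w x) <= pair_form c ij (slack w y).
Proof.
move=> c1 c2.
pose P (F : {set I}) x := [/\ envelope a w x, spanning w x
   & forall k, (k \in F) = (slack w x k == 0)].
(* [X F] is the vertex with tight set [F]; where there is none it defaults to 0, and [Pb] excludes
   such [F]. *)
have /choice [X XP] : forall F : {set I}, exists x, (exists y, P F y) -> P F x.
  move=> F; have [[x Px]|nP] := pselect (exists x, P F x); first by exists x.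
  by exists 0.
have tP x : envelope a w x -> spanning w x -> P [set k | slack w x k == 0]%SET x.
  by move=> Ex sx; split=> // k; rewrite inE.
have [x0 Ex0] := envelope_neq0 w.
have [x1 [Ex1 sx1 _ _]] := descend_to_vertex ij c1 c2 Ex0.
pose Pb F := `[< exists x, P F x >].
have P0 : Pb [set k | slack w x1 k == 0]%SET by apply/asboolP; exists x1; apply: tP.
have [F /asboolP PF Fmin] :=
  @arg_minP _ _ _ _ Pb (fun F => pair_form c ij (slack w (X F))) P0.
have [EF sF _] := XP F PF; exists (X F) => // y Ey.
have [z [Ez sz _ zy]] := descend_to_vertex ij c1 c2 Ey.
apply: le_trans zy; pose G := [set k | slack w z k == 0]%SET.
have PG : exists x, P G x by exists z; apply: tP.
have := Fmin G (introT (asboolP _) PG).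
have [_ _ XG] := XP G PG.
suff -> : X G = z by [].
by apply/esym/(spanning_uniq sz) => k zk; apply/eqP; rewrite -XG inE zk.
Qed.

(* An abstract split: a weight f together with finitely many nonnegative forms
   c on pairs of slacks.  A weight u refines the split iff all these forms are
   positive on its envelope, and the largest l for which l f can be subtracted
   coherently from u is the least ratio of such a form to its value on f. *)
Record split_tests (f : I -> R) (D : pred (I * I)) (c : I * I -> R * R) : Prop :=
  SplitTests {
    split_weight_ge0 : forall k, 0 <= f k;
    split_inhabited : exists ij, D ij;
    split_coef1 : forall ij, D ij -> 0 <= (c ij).1;
    split_coef2 : forall ij, D ij -> 0 <= (c ij).2;
    split_form_gt0 : forall ij, D ij -> 0 < pair_form (c ij) ij f;
    split_form_ev : forall l x ij, 0 <= l ->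
      envelope a (fun k => l * f k) x -> D ij -> 0 <= pair_form (c ij) ij (ev x);
    split_subtract : forall u x l, 0 <= l -> envelope a u x ->
      (forall ij, D ij ->
         l * pair_form (c ij) ij f <= pair_form (c ij) ij (slack u x)) ->
      exists2 y, envelope a (fun k => l * f k) y
               & envelope a (fun k => u k - l * f k) (x - y) }.

Definition refines (D : pred (I * I)) (c : I * I -> R * R) u : Prop :=
  forall x ij, envelope a u x -> D ij -> 0 < pair_form (c ij) ij (slack u x).

Lemma split_form_slack f D c l x ij : split_tests f D c -> 0 <= l ->
    envelope a (fun k => l * f k) x -> D ij ->
  l * pair_form (c ij) ij f <=
    pair_form (c ij) ij (slack (fun k => l * f k) x).
Proof.
move=> st l0 Ex Dij; rewrite -pair_formZ -[leLHS]addr0 pair_formD lerD2l.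
exact: split_form_ev st _ _ _ l0 Ex Dij.
Qed.

(** At a minimizer for the test of least ratio [l], the summand from the envelope of [l * f] takes
    up the whole form. Nothing positive remains, so the remainder does not refine the split. *)
Lemma coherency_index f D c u : split_tests f D c ->
  exists l, [/\ 0 <= l,
    forall x, envelope a u x -> exists2 y, envelope a (fun k => l * f k) y
      & envelope a (fun k => u k - l * f k) (x - y)
    & ~ refines D c (fun k => u k - l * f k)].
Proof.
move=> st; have [ij0 D0] := split_inhabited st.
have /choice [X XP] : forall ij, exists x, D ij -> envelope a u x /\
    forall y, envelope a u y ->
    pair_form (c ij) ij (slack u x) <= pair_form (c ij) ij (slack u y).
  move=> ij; case Dij: (D ij); last by exists 0.
  have [x Ex xmin] :=
    pair_form_min u ij (split_coef1 st Dij) (split_coef2 st Dij).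
  by exists x.
pose F ij := pair_form (c ij) ij (slack u (X ij)) / pair_form (c ij) ij f.
have [ij Dij ijmin] := @arg_minP _ _ _ ij0 D F D0.
have [EX Xmin] := XP ij Dij.
have l0 : 0 <= F ij.
  rewrite divr_ge0 ?(ltW (split_form_gt0 st Dij)) // pair_form_ge0 //.
  - exact: split_coef1 st _ Dij.
  - exact: split_coef2 st _ Dij.
  - exact/envelopeP.
have sub x : envelope a u x -> exists2 y, envelope a (fun k => F ij * f k) y
      & envelope a (fun k => u k - F ij * f k) (x - y).
  move=> Ex; apply: (split_subtract st) => // kl Dkl.
  rewrite -ler_pdivlMr ?(split_form_gt0 st) //; apply: le_trans (ijmin _ Dkl) _.
  rewrite ler_pM2r ?invr_gt0 ?(split_form_gt0 st) //.
  by have [_] := XP kl Dkl; apply.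
exists (F ij); split=> // strict.
have [y Ey Exy] := sub _ EX.
have := strict _ _ Exy Dij.
have := split_form_slack st l0 Ey Dij.
have : pair_form (c ij) ij (slack u (X ij)) = F ij * pair_form (c ij) ij f.
  by rewrite divfK // gt_eqF // (split_form_gt0 st).
rewrite /pair_form /slack !evD !evN; lra.
Qed.

(** * Coherent decompositions along a finite family of splits *)

Section Families.
Variables (J : finType) (f : J -> I -> R) (D : J -> pred (I * I)).
Variable c : J -> I * I -> R * R.
Implicit Types (l : J -> R) (s t : J) (P T : {set J}).

Lemma envelope_sum (A : {set J}) u (v : J -> I -> R) x (y : J -> 'rV[R]_(1 + d)) :
    envelope a u x -> (forall j, j \in A -> envelope a (v j) (y j)) ->
  envelope a (fun k => u k + \sum_(j in A) v j k) (x + \sum_(j in A) y j).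
Proof.
move=> /envelopeP Ex Ey; apply/envelopeP => k.
rewrite /slack evD ev_sum addrACA -big_split /= addr_ge0 ?Ex //.
by apply: sumr_ge0 => j /Ey /envelopeP /(_ k).
Qed.

Lemma pair_form_slack_sum (A : {set J}) e ij u (v : J -> I -> R) x
    (y : J -> 'rV[R]_(1 + d)) :
  pair_form e ij (slack (fun k => u k + \sum_(j in A) v j k)
                        (x + \sum_(j in A) y j)) =
  pair_form e ij (slack u x) + \sum_(j in A) pair_form e ij (slack (v j) (y j)).
Proof.
rewrite [in RHS]/pair_form big_split /= -!mulr_sumr addrACA -!mulrDr.
by rewrite /pair_form /slack !evD !ev_sum !big_split /=; ring.
Qed.

Definition add_splits w l P k := w k + \sum_(j in P) l j * f j k.

(** Coherence is recorded as one inclusion of envelopes; the reverse inclusion is [envelope_sum]. *)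
Definition coherent_sum w w0 l P :=
  [/\ forall j, j \in P -> 0 <= l j, w = add_splits w0 l P
    & forall x, envelope a w x -> exists x0 (y : J -> 'rV[R]_(1 + d)),
        [/\ envelope a w0 x0,
            forall j, j \in P -> envelope a (fun k => l j * f j k) (y j)
          & x = x0 + \sum_(j in P) y j]].

(** The largest multiple of [s] is taken from the first part of a decomposition along the other
    splits. These stay unrefined: adding the multiple of [s] back only adds nonnegative values to
    their forms. *)
Lemma exists_coherent_sum w P :
    (forall j, j \in P -> split_tests (f j) (D j) (c j)) ->
  exists w0 l, coherent_sum w w0 l P /\
    forall j, j \in P -> ~ refines (D j) (c j) w0.
Proof.
have [m] := ubnP #|P|; elim: m P => // m IHm P; rewrite ltnS => Pm st.
have [->|[s sP]] := set_0Vmem P.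
  exists w, (fun _ => 0); split; last by move=> j; rewrite inE.
  split; first by move=> j; rewrite inE.
    by apply/funext => k; rewrite /add_splits big_set0 addr0.
  move=> x Ex; exists x, (fun _ => 0).
  by rewrite big_set0 addr0; split=> // j; rewrite inE.
have [||w0 [l [[l0 wE dec] prime]]] := IHm (P :\ s).
- by apply: leq_trans Pm; rewrite [X in (_ < X)%N](cardsD1 s) sP.
- by move=> j /setD1P [_ /st].
have [r [r0 rdec rprime]] := coherency_index w0 (st _ sP).
pose l' j := if j == s then r else l j.
have l's : l' s = r by rewrite /l' eqxx.
have l'E j : j \in P :\ s -> l' j = l j by move=> /setD1P [/negbTE js _]; rewrite /l' js.
exists (fun k => w0 k - r * f s k), l'; split; first split.
- move=> j jP; have [->|js] := eqVneq j s; first by rewrite l's.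
  by rewrite l'E ?l0 // !inE js.
- apply/funext => k; rewrite wE /add_splits (big_setD1 s sP) /= l's addrA subrK.
  by congr (_ + _); apply: eq_bigr => j /l'E ->.
- move=> x /dec [x0 [y [Ex0 Ey ->]]].
  have [z Ez Exz] := rdec _ Ex0.
  exists (x0 - z), (fun j => if j == s then z else y j); split=> //.
    move=> j jP; have [->|js] := eqVneq j s; first by rewrite l's.
    have jPs : j \in P :\ s by rewrite !inE js.
    by rewrite l'E //; apply: Ey.
  rewrite (big_setD1 s sP) /= eqxx addrA subrK; congr (_ + _).
  by apply: eq_bigr => j /setD1P [/negbTE ->].
- move=> j jP; have [-> //|js] := eqVneq j s.
  move=> strict; apply: (prime j); first by rewrite !inE js.
  move=> x ij Ex Dij; have [z Ez Exz] := rdec _ Ex.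
  have -> : slack w0 x = slack (fun k => (w0 k - r * f s k) + r * f s k) (x - z + z).
    by rewrite subrK; apply/funext => k; rewrite /slack subrK.
  rewrite pair_form_slackD ltr_pwDl ?(strict _ _ Exz) //.
  rewrite pair_form_ge0 ?(split_coef1 (st _ jP)) ?(split_coef2 (st _ jP)) //.
  exact/envelopeP.
Qed.

Variable P : {set J}.
Hypothesis st : forall j, j \in P -> split_tests (f j) (D j) (c j).

(* A cancellation law: the sum over T need not be known to be coherent, so
   x is completed by minimizers of the same form for the splits outside T. *)
Lemma coherent_sum_form w w0 l T t x ij : coherent_sum w w0 l P ->
    T \subset P -> t \in T -> envelope a (add_splits w0 l T) x -> D t ij ->
  l t * pair_form (c t ij) ij (f t) <=
    pair_form (c t ij) ij (slack (add_splits w0 l T) x).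
Proof.
move=> [l0 wE dec] TP tT Ex Dij; have tP := fintype.subsetP TP _ tT.
have c1 := split_coef1 (st tP) Dij; have c2 := split_coef2 (st tP) Dij.
have /choice [Y YP] : forall j, exists y, envelope a (fun k => l j * f j k) y /\
    forall z, envelope a (fun k => l j * f j k) z ->
    pair_form (c t ij) ij (slack (fun k => l j * f j k) y) <=
    pair_form (c t ij) ij (slack (fun k => l j * f j k) z).
  by move=> j; have [y Ey ymin] := pair_form_min (fun k => l j * f j k) ij c1 c2; exists y.
have wE' : w = fun k => add_splits w0 l T k + \sum_(j in P :\: T) l j * f j k.
  apply/funext => k; rewrite wE /add_splits -addrA; congr (_ + _).
  by rewrite (big_setID T) /= (finset.setIidPr TP).
have : envelope a w (x + \sum_(j in P :\: T) Y j).
  by rewrite wE'; apply: envelope_sum => // j _; have [] := YP j.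
move=> /dec [x0 [y [Ex0 Ey eqx]]].
have := pair_form_slack_sum (P :\: T) (c t ij) ij (add_splits w0 l T)
  (fun j k => l j * f j k) x Y.
rewrite -wE' eqx {1}wE pair_form_slack_sum (big_setID T) /= (finset.setIidPr TP).
rewrite (bigD1 t tT) /=.
have lt_le := split_form_slack (st tP) (l0 _ tP) (Ey _ tP) Dij.
have x0_ge : 0 <= pair_form (c t ij) ij (slack w0 x0).
  by apply: pair_form_ge0 => //; apply/envelopeP.
have rest_ge : 0 <= \sum_(j in T | j != t)
    pair_form (c t ij) ij (slack (fun k => l j * f j k) (y j)).
  apply: sumr_ge0 => j /andP [jT _]; apply: pair_form_ge0 => //; apply/envelopeP.
  exact: Ey (fintype.subsetP TP _ jT).
(* Each [Y j] minimizes the form, so the outside summands of the given decomposition are at least as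
   large and drop out of the comparison. *)
have out_ge : \sum_(j in P :\: T) pair_form (c t ij) ij (slack (fun k => l j * f j k) (Y j))
   <= \sum_(j in P :\: T) pair_form (c t ij) ij (slack (fun k => l j * f j k) (y j)).
  apply: ler_sum => j /setDP [jP _]; have [_] := YP j; apply; exact: Ey.
move: out_ge rest_ge x0_ge lt_le; lra.
Qed.

Hypothesis refines_remove : forall s t u (l : R), s \in P -> t \in P -> s != t -> 0 < l ->
  (forall x ij, envelope a (fun k => u k + l * f t k) x -> D t ij ->
     l * pair_form (c t ij) ij (f t) <=
       pair_form (c t ij) ij (slack (fun k => u k + l * f t k) x)) ->
  refines (D s) (c s) (fun k => u k + l * f t k) -> refines (D s) (c s) u.

Lemma coherent_sum_le w w0 l w0' l' s :
    coherent_sum w w0 l P -> coherent_sum w w0' l' P -> s \in P ->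
    ~ refines (D s) (c s) w0 ->
  l' s <= l s.
Proof.
move=> H H' sP nref; rewrite leNgt; apply/negP => lts; apply: nref.
have [l0 wE _] := H; have [_ wE' _] := H'.
(* By [coherent_sum_form] for the second decomposition, every form on the envelope of [w] is at
   least [l' s] times its value on [f s]; subtracting the smaller multiple [l s] leaves it
   positive. *)
have start : refines (D s) (c s) (add_splits w0 l (P :\ s)).
  have wsE : w = fun k => add_splits w0 l (P :\ s) k + l s * f s k.
    by apply/funext => k; rewrite wE /add_splits (big_setD1 s sP) /= -addrA [in RHS](addrC (\sum_(_ in _) _)).
  move=> x ij Ex Dij.
  have Ewx : envelope a w x.
    rewrite wsE; apply/envelopeP => k; move/envelopeP: Ex => /(_ k).
    have := mulr_ge0 (l0 _ sP) (split_weight_ge0 (st sP) k).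
    rewrite /slack; lra.
  have Ewx' := Ewx; rewrite {1}wE' in Ewx'.
  have := coherent_sum_form H' (subxx _) sP Ewx' Dij; rewrite -wE' {1}wsE.
  have -> : pair_form (c s ij) ij (slack (fun k => add_splits w0 l (P :\ s) k + l s * f s k) x) =
     pair_form (c s ij) ij (slack (add_splits w0 l (P :\ s)) x) + l s * pair_form (c s ij) ij (f s).
    by rewrite /pair_form /slack; ring.
  rewrite -lerBlDr -mulrBl; apply: lt_le_trans.
  by rewrite mulr_gt0 ?subr_gt0 // (split_form_gt0 (st sP)).
(* The other splits are removed one at a time; those with coefficient zero need no appeal to
   [refines_remove]. *)
suff step T : T \subset P -> s \notin T -> refines (D s) (c s) (add_splits w0 l T) ->
    refines (D s) (c s) w0.
  by apply: (step (P :\ s)) => //; rewrite ?finset.subsetDl // !inE eqxx.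
have [m] := ubnP #|T|; elim: m T => // m IHm T; rewrite ltnS => Tm TP sT.
have [->|[t tT]] := set_0Vmem T.
  suff -> : add_splits w0 l finset.set0 = w0 by [].
  by apply/funext => k; rewrite /add_splits big_set0 addr0.
have tP := fintype.subsetP TP _ tT.
have TE : add_splits w0 l T = fun k => add_splits w0 l (T :\ t) k + l t * f t k.
  by apply/funext => k; rewrite /add_splits (big_setD1 t tT) /= -addrA [in RHS](addrC (\sum_(_ in _) _)).
have st_ : s != t by apply: contraNneq sT => ->.
move=> strict; apply: (IHm (T :\ t)).
- by apply: leq_trans Tm; rewrite [X in (_ < X)%N](cardsD1 t) tT.
- exact: fintype.subset_trans (finset.subsetDl _ _) TP.
- by rewrite !inE negb_and sT orbT.
have [lt0|] := eqVneq (l t) 0.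
  suff <- : add_splits w0 l T = add_splits w0 l (T :\ t) by [].
  by rewrite TE; apply/funext => k; rewrite lt0 mul0r addr0.
move=> ltn0; apply: (@refines_remove s t _ (l t)) => //.
- by rewrite lt_def ltn0 l0.
- rewrite -TE => x ij Ex Dij; exact: coherent_sum_form H TP tT Ex Dij.
- by rewrite -TE.
Qed.

End Families.
End Envelope.

(** * Splits and their forms *)

Section ConcreteSplits.
Variables (R : realType) (d : nat) (I : finType) (a : I -> 'rV[R]_d).
Implicit Types (F G : {set I}) (w u v : I -> R) (x z h : 'rV[R]_(1 + d)).
Implicit Types (y : 'rV[R]_d) (k p q : I).

Local Notation ev := (ev a).
Local Notation slack := (slack a).
Local Notation evp y x := (dotv (row_mx 1%:M y) x).

Lemma evp_comb (t : I -> R) x : \sum_k t k = 1 ->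
  evp (\sum_k t k *: a k) x = \sum_k t k * ev x k.
Proof.
have [s [c ->]] := row_mx_surj x => t1.
rewrite dotv_row_mx mul1r dotvC dotv_sumr -[X in X + _]mulr1 -{1}t1.
rewrite mulr_sumr -big_split /=.
by apply: eq_bigr => k _; rewrite ev_row dotvZr [s * _]mulrC mulrDr.
Qed.

(** Only indices with negative [e k] limit the step; there [s k] is positive, and the least of the
    finitely many ratios works. *)
Lemma small_step (s e : I -> R) :
    (forall k, 0 <= s k) -> (forall k, s k = 0 -> 0 <= e k) ->
  exists2 r, 0 < r & forall k, 0 <= s k + r * e k.
Proof.
move=> s0 se; have [[k0 k0lt]|npos] := pselect (exists k, e k < 0); last first.
  exists 1 => // k; rewrite mul1r addr_ge0 // leNgt.
  by apply/negP => ek; apply: npos; exists k.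
pose m k := s k / - e k.
have [k klt kmin] := @arg_minP _ _ _ k0 (fun k => e k < 0) m k0lt.
have m0 : 0 < m k.
  rewrite divr_gt0 ?oppr_gt0 // lt_def s0 andbT.
  by apply: contraTneq klt => /se; rewrite -leNgt.
exists (m k) => // i; have [ige|ilt] := leP 0 (e i).
  by rewrite addr_ge0 // mulr_ge0 // ltW.
have := kmin i ilt; rewrite [X in _ <= X]/m ler_pdivlMr ?oppr_gt0 // mulrN => hi.
by rewrite -lerBlDr sub0r.
Qed.

(** Coefficients are collected by label, so that later combinations are indexed by [I] itself. *)
Lemma conv_comb F y : conv a F y <-> exists t : I -> R,
  [/\ forall k, 0 <= t k, forall k, k \notin F -> t k = 0, \sum_k t k = 1
    & y = \sum_k t k *: a k].
Proof.
split=> [[m [z [t [az t0 t1 ->]]]]|[t [t0 tF t1 ->]]]; last first.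
  pose g (i : 'I_#|F|) := enum_val i.
  exists #|F|, (fun i => a (g i)), (fun i => t (g i)); split=> //.
  - by move=> i; exists (g i) => //; exact: enum_valP.
  - rewrite -t1 [RHS](bigID (mem F)) /= [X in _ + X]big1 ?addr0; last by move=> k /tF.
    by rewrite [RHS](big_enum_val t).
  - rewrite [LHS](bigID (mem F)) /= [X in _ + X]big1 ?addr0; last first.
      by move=> k /tF ->; rewrite scale0r.
    by rewrite [LHS](big_enum_val (fun k => t k *: a k)).
have /choice [g gP] : forall k : 'I_m, exists i, i \in F /\ a i = z k.
  by move=> k; have [i iF <-] := az k; exists i.
exists (fun i => \sum_(k | g k == i) t k); split.
- by move=> i; apply: sumr_ge0.
- by move=> i iF; rewrite big1 // => k /eqP gk; have [] := gP k; rewrite gk (negbTE iF).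
- by rewrite -t1 [RHS](partition_big g predT).
- rewrite (partition_big g predT) //=; apply: eq_bigr => i _.
  by rewrite scaler_suml; apply: eq_bigr => k /eqP <-; have [_ ->] := gP k.
Qed.

(* The forms of a 2-split express that the lifted points i and j lie above
   the crossing point of the segment [a_i, a_j] with the hyperplane h = 0. *)
Definition point_test p : pred (I * I) := pred1 (p, p).
Definition point_coef : I * I -> R * R := fun _ => (1, 0).
Definition crossing_test h : pred (I * I) := fun ij => (0 < ev h ij.1) && (ev h ij.2 < 0).
Definition crossing_coef h : I * I -> R * R := fun ij => (- ev h ij.2, ev h ij.1).

Definition pos_side h : {set I} := [set k | 0 <= ev h k]%SET.
Definition neg_side h : {set I} := [set k | ev h k <= 0]%SET.

(** The point [a p] is a convex combination of other points, where [weight1 R p] vanishes; this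
    gives the bound on [ev x p]. In the subtraction, the summand 0 suffices. *)
Lemma split_tests1 p : is_1split_point a p ->
  split_tests a (weight1 R p) (point_test p) point_coef.
Proof.
move=> /conv_comb [t [t0 tp t1 ap]]; split.
- by move=> k; rewrite ler0n.
- by exists (p, p); apply/eqP.
- by move=> *; rewrite ler01.
- by move=> *; rewrite lexx.
- by move=> _ /eqP ->; rewrite /pair_form /weight1 /= eqxx mul1r mul0r addr0 ltr01.
- move=> l x _ l0 /envelopeP Ex /eqP ->; rewrite /pair_form /= mul0r addr0 mul1r.
  have -> : ev x p = evp (a p) x by [].
  rewrite ap evp_comb //; apply: sumr_ge0 => k _.
  have [->|kp] := eqVneq k p; first by rewrite tp ?mul0r // !inE eqxx.
  have := Ex k; rewrite /slack /weight1 (negbTE kp) mulr0 add0r => Exk.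
  exact: mulr_ge0.
- move=> u x l l0 /envelopeP Ex /(_ (p, p) (eqxx _)).
  rewrite /pair_form /weight1 /= eqxx !mul1r !mul0r !addr0 mulr1 => lep.
  exists 0; first by apply/envelopeP => k; rewrite /slack ev0 addr0 mulr_ge0.
  rewrite subr0; apply/envelopeP => k; move: (Ex k); rewrite /slack.
  have [->|_] := eqVneq k p; last by rewrite mulr0 subr0.
  by move=> _; move: lep; rewrite /slack mulr1; lra.
Qed.

Lemma pair_form2 h ij (s : I -> R) :
  pair_form (crossing_coef h ij) ij s = - ev h ij.2 * s ij.1 + ev h ij.1 * s ij.2.
Proof. by []. Qed.

(** The segment from [a i] to [a j] crosses [h = 0] at a point in the hull of one side. As [h] keeps
    its sign on that side, the point is a convex combination of configuration points with [h = 0],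
    where [x] is nonnegative. *)
Lemma crossing_form_ge0 h x i j : 0 < ev h i -> ev h j < 0 ->
    (forall y, conv a [set: I] y -> conv a (pos_side h) y \/ conv a (neg_side h) y) ->
    (forall k, ev h k = 0 -> 0 <= ev x k) ->
  0 <= - ev h j * ev x i + ev h i * ev x j.
Proof.
move=> hi hj cover x0; pose m := ev h i - ev h j.
have m0 : 0 < m by rewrite /m; lra.
(* Barycentric coordinates of the crossing point. *)
pose t k := (k == i)%:R * (- ev h j / m) + (k == j)%:R * (ev h i / m).
have sumt (g : I -> R) : \sum_k t k * g k = (- ev h j * g i + ev h i * g j) / m.
  under eq_bigr do rewrite mulrDl.
  rewrite big_split /= (bigD1 i) //= [X in _ + X + _]big1; last first.
    by move=> k /negbTE ->; rewrite !mul0r.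
  rewrite [X in _ + X](bigD1 j) //= [X in _ + (_ + X)]big1; last first.
    by move=> k /negbTE ->; rewrite !mul0r.
  by rewrite !eqxx !mul1r; ring.
have t1 : \sum_k t k = 1.
  under eq_bigr do rewrite -[t _]mulr1.
  by rewrite sumt !mulr1 addrC divff // gt_eqF.
have yA : conv a [set: I] (\sum_k t k *: a k).
  apply/conv_comb; exists t; split=> // [k|k]; last by rewrite inE.
  by rewrite addr_ge0 // mulr_ge0 // divr_ge0 ?oppr_ge0 // ltW.
suff side (r : I -> R) : (forall k, 0 <= r k) -> \sum_k r k = 1 ->
    \sum_k t k *: a k = \sum_k r k *: a k ->
    (forall k, r k != 0 -> 0 <= ev h k) \/ (forall k, r k != 0 -> ev h k <= 0) ->
    0 <= - ev h j * ev x i + ev h i * ev x j.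
  have [/conv_comb [r [r0 rF r1 yr]]|/conv_comb [r [r0 rF r1 yr]]] := cover _ yA.
    apply: (side r) => //; left=> k; apply: contraNT => hk; apply/eqP; apply: rF.
    by rewrite inE.
  apply: (side r) => //; right=> k; apply: contraNT => hk; apply/eqP; apply: rF.
  by rewrite inE.
move=> r0 r1 yr hr.
have eqe z : \sum_k t k * ev z k = \sum_k r k * ev z k by rewrite -!evp_comb // yr.
have rh : \sum_k r k * ev h k = 0.
  by rewrite -eqe sumt mulNr [ev h j * _]mulrC addNr mul0r.
have rh0 k : r k * ev h k = 0.
  have [hr1|hr1] := hr.
    have pos l : 0 <= r l * ev h l.
      by have [->|/hr1 ?] := eqVneq (r l) 0; [rewrite mul0r|exact: mulr_ge0].
    by move/eqP: rh; rewrite psumr_eq0 // => /allP /(_ k (mem_index_enum k)) /eqP.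
  have pos l : 0 <= - (r l * ev h l).
    have [->|/hr1 ?] := eqVneq (r l) 0; first by rewrite mul0r oppr0.
    by rewrite -mulrN mulr_ge0 // oppr_ge0.
  move/eqP: rh; rewrite -oppr_eq0 -sumrN psumr_eq0 //.
  by move=> /allP /(_ k (mem_index_enum k)); rewrite oppr_eq0 => /eqP.
have := eqe x; rewrite sumt => /(congr1 (fun e => e * m)); rewrite divfK ?gt_eqF // => ->.
apply: mulr_ge0 (ltW m0); apply: sumr_ge0 => k _.
have /eqP := rh0 k; rewrite mulf_eq0 => /orP [/eqP ->|/eqP hk]; first by rewrite mul0r.
by rewrite mulr_ge0 // x0.
Qed.

Lemma split_tests2 h :
    (forall y, conv a [set: I] y -> conv a (pos_side h) y \/ conv a (neg_side h) y) ->
    (exists i, 0 < ev h i) -> (exists j, ev h j < 0) ->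
  split_tests a (fun k => `|ev h k|) (crossing_test h) (crossing_coef h).
Proof.
move=> cover [i0 hi0] [j0 hj0]; split.
- by move=> k; exact: normr_ge0.
- by exists (i0, j0); rewrite /crossing_test /= hi0.
- by move=> ij /andP [_ /ltW]; rewrite oppr_ge0.
- by move=> ij /andP [/ltW].
- move=> [i j] /andP [/= hi hj].
  rewrite pair_form2 /= gtr0_norm // ltr0_norm // [ev h i * _]mulrC.
  by rewrite addr_gt0 // mulr_gt0 // oppr_gt0.
- move=> l x [i j] l0 /envelopeP Ex /andP [/= hi hj]; rewrite pair_form2 /=.
  apply: crossing_form_ge0 => // k hk.
  by have := Ex k; rewrite /slack hk normr0 mulr0 add0r.
- move=> u x l l0 /envelopeP Ex lef.
  pose m k := slack u x k / - ev h k.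
  have [j hj jmin] := @arg_minP _ _ _ j0 (fun k => ev h k < 0) m hj0.
  have m0 : 0 <= m j by rewrite divr_ge0 // oppr_ge0 ltW.
  (* For the summand [t *: h], the envelope of [l * |h|] asks for [|t| <= l], and the points with
     [h < 0] ask for [t >= l - m j]. The least such [t] is taken; the tests of the pairs [(k, j)]
     then settle the points with [h > 0]. *)
  pose t := Num.max (- l) (l - m j).
  have t1 : - l <= t by rewrite le_max lexx.
  have t2 : l - m j <= t by rewrite le_max lexx orbT.
  have t3 : t <= l by rewrite ge_max; apply/andP; split; lra.
  have slackE k : slack (fun k => u k - l * `|ev h k|) (x - t *: h) k =
      slack u x k - l * `|ev h k| - t * ev h k.
    by rewrite /slack evD evN evZ; ring.
  exists (t *: h); apply/envelopeP => k.
    rewrite /slack evZ; have [hk|hk] := leP 0 (ev h k).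
      by rewrite ger0_norm // -mulrDl mulr_ge0 //; lra.
    by rewrite ltr0_norm // mulrN -mulNr -mulrDl mulr_le0 ?(ltW hk) //; lra.
  rewrite slackE; case: (ltrgt0P (ev h k)) => hk.
  + have le2 : 2 * l * ev h k <= slack u x k + m j * ev h k.
      have := lef (k, j); rewrite /crossing_test /= hk hj => /(_ isT).
      rewrite !pair_form2 /= gtr0_norm // ltr0_norm // => lekj.
      have nj : 0 < - ev h j by rewrite oppr_gt0.
      rewrite -(ler_pM2r nj).
      have -> : (slack u x k + m j * ev h k) * - ev h j =
         - ev h j * slack u x k + ev h k * slack u x j.
        have : m j * - ev h j = slack u x j by rewrite divfK // gt_eqF.
        by move=> <-; ring.
      apply: le_trans lekj; lra.
    have [tE|tE] : t = - l \/ t = l - m j.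
        by rewrite /t maxEle; case: ifP; [right|left].
      by rewrite tE; have := Ex k; lra.
    by rewrite tE; lra.
  + have /= := jmin k hk; rewrite [X in _ <= X]/m ler_pdivlMr ?oppr_gt0 // => mk.
    suff : (l - t) * - ev h k <= slack u x k by lra.
    apply: le_trans mk; rewrite ler_pM2r ?oppr_gt0 //; lra.
  + by rewrite hk; have := Ex k; lra.
Qed.

(* Moving x slightly in direction z keeps it in the envelope of u + l f, so
   the lower bound on the forms there forces the form of z to be nonnegative. *)
Lemma tight_form_ge0 (f : I -> R) (D : pred (I * I)) (c : I * I -> R * R) u (l : R) x z ij :
    (forall k, 0 <= f k) -> 0 < l ->
    (forall x ij, envelope a (fun k => u k + l * f k) x -> D ij ->
       l * pair_form (c ij) ij f <=
         pair_form (c ij) ij (slack (fun k => u k + l * f k) x)) ->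
    envelope a u x -> D ij -> slack u x ij.1 = 0 -> slack u x ij.2 = 0 ->
    (forall k, slack u x k = 0 -> f k = 0 -> 0 <= ev z k) ->
  0 <= pair_form (c ij) ij (ev z).
Proof.
move=> f0 l0 lef /envelopeP Ex Dij x1 x2 zk.
have [||r r0 rk] := @small_step (fun k => slack u x k + l * f k) (ev z).
- by move=> k; rewrite addr_ge0 // mulr_ge0 // ltW.
- move=> k /eqP; rewrite paddr_eq0 // ?mulr_ge0 ?(ltW l0) //.
  by rewrite mulf_eq0 (gt_eqF l0) /= => /andP [/eqP ? /eqP]; apply: zk.
have slackE k : slack (fun k => u k + l * f k) (x + r *: z) k =
    slack u x k + l * f k + r * ev z k.
  by rewrite /slack evD evZ; ring.
have Er : envelope a (fun k => u k + l * f k) (x + r *: z).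
  by apply/envelopeP => k; rewrite slackE.
have := lef _ _ Er Dij; rewrite /pair_form !slackE x1 x2 !add0r => le.
have {le} : 0 <= r * pair_form (c ij) ij (ev z) by move: le; rewrite /pair_form; lra.
by rewrite pmulr_rge0.
Qed.

Lemma sign_mul_ge0 (e : R) : 0 <= (-1) ^+ (~~ (0 <= e)) * e.
Proof.
have [e0|/ltW e0] := leP 0 e; first by rewrite expr0 mul1r.
by rewrite expr1 mulN1r oppr_ge0.
Qed.

(** The weight [l * |h|] has two affine pieces: [b = true] selects the one tight where [h >= 0],
    [b = false] the one tight where [h <= 0]. Adding a piece keeps a cell tight on that side. *)
Lemma envelope_sign h (l : R) b : 0 <= l ->
  envelope a (fun k => l * `|ev h k|) ((-1) ^+ b *: (l *: h)).
Proof.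
move=> l0; apply/envelopeP => k; rewrite /slack !evZ mulrCA -mulrDr mulr_ge0 //.
rewrite -lerBlDr sub0r; apply: le_trans (ler_norm _) _.
by rewrite normrN normrM normr_sign mul1r.
Qed.

Lemma slack_sign h (l : R) b k : 0 <= (-1) ^+ (~~ b) * ev h k ->
  slack (fun k => l * `|ev h k|) ((-1) ^+ b *: (l *: h)) k = 0.
Proof.
rewrite /slack !evZ; case: b; rewrite ?expr1 ?expr0 ?mulN1r ?mul1r => hk.
  by rewrite ger0_norm // subrr.
by rewrite ler0_norm ?mulrN ?addNr // -oppr_ge0.
Qed.

(** * Refining a split, and removal of a multiple of another split *)

Lemma refines_pair (D : pred (I * I)) (c : I * I -> R * R) u :
    (forall ij, D ij -> 0 < (c ij).1 /\ 0 <= (c ij).2) ->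
    (forall x ij, envelope a u x -> D ij -> slack u x ij.1 = 0 ->
       (c ij).2 * slack u x ij.2 = 0 -> False) ->
  refines a D c u.
Proof.
move=> c0 nt x ij Ex Dij; have [c1 c2] := c0 _ Dij; have /envelopeP sx := Ex.
have f1 := mulr_ge0 (ltW c1) (sx ij.1); have f2 := mulr_ge0 c2 (sx ij.2).
rewrite lt_def addr_ge0 // andbT; apply/negP.
rewrite /pair_form paddr_eq0 // mulf_eq0 (gt_eqF c1) /= => /andP [/eqP s1 /eqP s2].
exact: nt Ex Dij s1 s2.
Qed.

Lemma refines1P p u :
  refines a (point_test p) point_coef u <-> forall x, envelope a u x -> slack u x p != 0.
Proof.
split=> [ref x Ex|ref].
  by have := ref x (p, p) Ex (eqxx _); rewrite /pair_form /= mul0r addr0 mul1r => /gt_eqF ->.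
apply: refines_pair => [ij _|x ij Ex /eqP ->]; first by rewrite ltr01 lexx.
by move=> /eqP; rewrite (negbTE (ref x Ex)).
Qed.

Lemma refines2P h u :
  refines a (crossing_test h) (crossing_coef h) u <-> forall x i j, envelope a u x ->
    0 < ev h i -> ev h j < 0 -> slack u x i = 0 -> slack u x j = 0 -> False.
Proof.
split=> [ref x i j Ex hi hj xi xj|ref].
  have := ref x (i, j) Ex; rewrite /crossing_test /= hi hj => /(_ isT).
  by rewrite pair_form2 /= xi xj !mulr0 addr0 ltxx.
apply: refines_pair => [ij /andP [hi hj]|x ij Ex /andP [hi hj] xi /eqP].
  by rewrite /= oppr_gt0 hj ltW.
rewrite mulf_eq0 (gt_eqF hi) /= => /eqP xj.
exact: ref Ex hi hj xi xj.
Qed.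

Lemma refines1_remove1 p q u (l : R) : p != q -> 0 < l ->
  refines a (point_test p) point_coef (fun k => u k + l * weight1 R q k) ->
  refines a (point_test p) point_coef u.
Proof.
move=> pq l0 /refines1P ref; apply/refines1P => x Ex.
have := ref x; rewrite /slack /weight1 (negbTE pq) mulr0 addr0; apply.
apply/envelopeP => k; have /envelopeP/(_ k) := Ex; rewrite /slack.
by move=> s0; rewrite addrAC addr_ge0 // mulr_ge0 ?ler0n ?ltW.
Qed.

(** Adding the affine piece of [l * |h|] that is tight at [p] leaves the slack at [p] unchanged. *)
Lemma refines1_remove2 p h u (l : R) : 0 < l ->
  refines a (point_test p) point_coef (fun k => u k + l * `|ev h k|) ->
  refines a (point_test p) point_coef u.
Proof.
move=> /ltW l0 /refines1P ref; apply/refines1P => x Ex.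
pose b := 0 <= ev h p.
have := ref _ (envelopeD Ex (envelope_sign h b l0)).
suff s0 : slack (fun k => l * `|ev h k|) ((-1) ^+ b *: (l *: h)) p = 0.
  have : slack u x p + slack (fun k => l * `|ev h k|) ((-1) ^+ b *: (l *: h)) p = slack u x p.
    by rewrite s0 addr0.
  by rewrite /slack evD addrACA => ->.
exact/slack_sign/sign_mul_ge0.
Qed.

(** Adding the weight of [q] changes no slack except at [q], so a cell with [i] and [j] on opposite
    sides must have [q] among them. Then [q] is the only tight point strictly on its side, and the
    lower bound, tested in direction [h] or [- h], excludes that. *)
Lemma refines2_remove1 q h u (l : R) : 0 < l ->
    (forall x ij, envelope a (fun k => u k + l * weight1 R q k) x -> point_test q ij ->
       l * pair_form (point_coef ij) ij (weight1 R q) <=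
         pair_form (point_coef ij) ij (slack (fun k => u k + l * weight1 R q k) x)) ->
    refines a (crossing_test h) (crossing_coef h) (fun k => u k + l * weight1 R q k) ->
  refines a (crossing_test h) (crossing_coef h) u.
Proof.
move=> l0 lef /refines2P ref; apply/refines2P => x i j Ex hi hj xi xj.
have Ex' : envelope a (fun k => u k + l * weight1 R q k) x.
  apply/envelopeP => k; have /envelopeP/(_ k) := Ex; rewrite /slack.
  by move=> s0; rewrite addrAC addr_ge0 // mulr_ge0 ?ler0n ?ltW.
have slackE k : k != q -> slack (fun k => u k + l * weight1 R q k) x k = slack u x k.
  by move=> kq; rewrite /slack /weight1 (negbTE kq) mulr0 addr0.
have tight z : slack u x q = 0 -> (forall k, slack u x k = 0 -> k != q -> 0 <= ev z k) ->
    0 <= ev z q.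
  move=> xq zk.
  have := @tight_form_ge0 (weight1 R q) (point_test q) point_coef u l x z (q, q)
    (fun k => ler0n _ _) l0 lef Ex (eqxx _) xq xq.
  rewrite /pair_form /= mul0r mul1r addr0; apply=> k xk /eqP.
  by rewrite pnatr_eq0 eqb0; apply: zk.
have [iq|iq] := eqVneq i q.
  have jq : j != q by apply: contraTneq hj => ->; rewrite -iq -leNgt ltW.
  have := tight (- h); rewrite -iq evN => /(_ xi) /=; rewrite oppr_ge0 leNgt hi.
  suff hk k : slack u x k = 0 -> k != i -> 0 <= ev (- h) k by move/(_ hk).
  rewrite evN oppr_ge0 leNgt iq => xk kq; apply/negP => hk.
  by apply: (ref x k j Ex' hk hj); rewrite slackE.
have [jq|jq] := eqVneq j q.
  have := tight h; rewrite -jq => /(_ xj) /=; rewrite leNgt hj.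
  suff hk k : slack u x k = 0 -> k != j -> 0 <= ev h k by move/(_ hk).
  rewrite leNgt jq => xk kq; apply/negP => hk.
  by apply: (ref x i k Ex' hi hk); rewrite slackE.
by apply: (ref x i j Ex' hi hj); rewrite slackE.
Qed.

(** Here [K] is a cell, and [s], [t] are the values of two hyperplane equations on it. Up to a
    global sign, [t] has the sign of [s] wherever [s] is nonzero, so [s] vanishes where [t] does.
    The last hypothesis then applies to [s] and [- s], and the resulting equalities make the ratio
    [t / s] constant. *)
Lemma crossing_collinear (K : I -> Prop) (s t : I -> R) i0 j0 :
    K i0 -> K j0 -> 0 < s i0 -> s j0 < 0 ->
    (forall i j, K i -> K j -> 0 < s i -> s j < 0 -> t i * t j < 0) ->
    (forall e i j, (exists b : bool, e = fun k => (-1) ^+ b * s k) ->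
       (forall k, K k -> t k = 0 -> e k <= 0) ->
       K i -> K j -> 0 < t i -> t j < 0 -> - t j * e i + t i * e j <= 0) ->
  exists2 r, r != 0 & forall k, K k -> t k = r * s k.
Proof.
move=> Ki0 Kj0 si0 sj0.
wlog ti0 : t / 0 < t i0.
  move=> th opp cross; have [ti0|ti0|ti0] := ltrgt0P (t i0); first exact: th.
    have [|||r r0 rE] := th (fun k => - t k).
    - by rewrite oppr_gt0.
    - by move=> i j Ki Kj si sj; rewrite mulrNN; apply: opp.
    - move=> e i j eb eK Ki Kj; rewrite oppr_gt0 oppr_lt0 => ti tj.
      have := cross e j i eb; rewrite opprK => /(_ _ Kj Ki tj ti) le.
      have {}le : - t i * e j + t j * e i <= 0.
        by apply: le => k Kk tk; apply: eK => //; rewrite tk oppr0.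
      lra.
    by exists (- r) => [|k /rE]; [rewrite oppr_eq0|move=> tk; rewrite mulNr -tk opprK].
  by have := opp i0 j0 Ki0 Kj0 si0 sj0; rewrite ti0 mul0r ltxx.
move=> opp cross.
have tj0 : t j0 < 0 by have := opp _ _ Ki0 Kj0 si0 sj0; rewrite pmulr_rlt0.
have tpos i : K i -> 0 < s i -> 0 < t i.
  by move=> Ki si; have := opp _ _ Ki Kj0 si sj0; rewrite nmulr_llt0.
have tneg j : K j -> s j < 0 -> t j < 0.
  by move=> Kj sj; have := opp _ _ Ki0 Kj si0 sj; rewrite pmulr_rlt0.
have zero k : K k -> t k = 0 -> s k = 0.
  move=> Kk tk; have [sk|sk|//] := ltrgt0P (s k).
    by have := tpos _ Kk sk; rewrite tk ltxx.
  by have := tneg _ Kk sk; rewrite tk ltxx.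
have le1 i j : K i -> K j -> 0 < t i -> t j < 0 -> - t j * s i + t i * s j = 0.
  move=> Ki Kj ti tj.
  have := cross (fun k => s k) i j.
  have := cross (fun k => - s k) i j.
  move=> le1 le2; apply/le_anti/andP; split.
    apply: le2 => //; first by exists false; apply/funext => k; rewrite ?expr0 mul1r.
    by move=> k Kk /(zero _ Kk) ->.
  suff : - t j * - s i + t i * - s j <= 0 by lra.
  apply: le1 => //; first by exists true; apply/funext => k; rewrite ?expr1 mulN1r.
  by move=> k Kk /(zero _ Kk) ->; rewrite oppr0.
have ratio i j : K i -> K j -> 0 < s i -> s j < 0 -> t i / s i = t j / s j.
  move=> Ki Kj si sj.
  have e := le1 _ _ Ki Kj (tpos _ Ki si) (tneg _ Kj sj).
  apply/eqP; rewrite eqr_div ?(gt_eqF si) ?(lt_eqF sj) //; apply/eqP; lra.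
exists (t i0 / s i0) => [|k Kk]; first by rewrite mulf_neq0 ?invr_neq0 // gt_eqF.
have [sk|sk|sk] := ltrgt0P (s k).
- by rewrite (ratio i0 j0) // -(ratio k j0) // divfK // gt_eqF.
- by rewrite (ratio i0 k) // divfK // lt_eqF.
- rewrite sk mulr0; have [tk|tk|//] := ltrgt0P (t k).
    have := le1 _ _ Kk Kj0 tk tj0; rewrite sk mulr0 add0r => /eqP.
    by rewrite mulf_eq0 gt_eqF // lt_eqF.
  have := le1 _ _ Ki0 Kk ti0 tk; rewrite sk mulr0 addr0 => /eqP.
  by rewrite mulf_eq0 oppr_eq0 lt_eqF // gt_eqF.
Qed.

Hypothesis ha : is_point_configuration a.

(** In a cell crossing [h], points strictly separated by [h] are strictly separated by [g]:
    otherwise one affine piece of [l * |g|] is tight at both. With the lower bound in the directions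
    [h] and [- h], this makes [g] and [h] proportional on the cell; the cell of a vertex determines
    them everywhere. *)
Lemma refines2_remove2 h g u (l : R) : 0 < l ->
    ~ (exists2 r, r != 0 & g = r *: h) ->
    (forall x ij, envelope a (fun k => u k + l * `|ev g k|) x -> crossing_test g ij ->
       l * pair_form (crossing_coef g ij) ij (fun k => `|ev g k|) <=
         pair_form (crossing_coef g ij) ij (slack (fun k => u k + l * `|ev g k|) x)) ->
    refines a (crossing_test h) (crossing_coef h) (fun k => u k + l * `|ev g k|) ->
  refines a (crossing_test h) (crossing_coef h) u.
Proof.
move=> l0 ngh lef /refines2P ref; apply/refines2P => x' i0 j0 Ex' hi0 hj0 x'i x'j.
(* The zero form is used, as only a vertex with at least the same tight points is wanted. *)
have [x [Ex sx keep _]] :=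
  descend_to_vertex ha (c := (0, 0)) (i0, i0) (lexx 0) (lexx 0) Ex'.
apply: ngh.
have [||r r0 rE] := @crossing_collinear (fun k => slack u x k = 0) (ev h) (ev g) i0 j0
    (keep _ x'i) (keep _ x'j) hi0 hj0.
- move=> i j xi xj hi hj; rewrite ltNge; apply/negP => gij.
  have [b [bi bj]] : exists b : bool,
      0 <= (-1) ^+ (~~ b) * ev g i /\ 0 <= (-1) ^+ (~~ b) * ev g j.
    have [gi|gi|gi] := ltrgt0P (ev g i).
    + by exists true; rewrite /= ?expr0 !mul1r ltW //; move: gij; rewrite pmulr_rge0.
    + by exists false; rewrite /= ?expr1 !mulN1r !oppr_ge0 ltW //; move: gij; rewrite nmulr_rge0.
    + exists (0 <= ev g j); rewrite gi mulr0 lexx; split=> //.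
      exact: sign_mul_ge0.
  have slackE k : 0 <= (-1) ^+ (~~ b) * ev g k -> slack u x k = 0 ->
      slack (fun k => u k + l * `|ev g k|) (x + (-1) ^+ b *: (l *: g)) k = 0.
    move=> /(slack_sign l) s0 s1.
    by rewrite /slack evD addrACA -/(slack u x k) s1 add0r.
  have E := envelopeD Ex (envelope_sign g b (ltW l0)).
  exact: ref E hi hj (slackE _ bi xi) (slackE _ bj xj).
- move=> e i j [b ->] eK xi xj gi gj.
  have := @tight_form_ge0 (fun k => `|ev g k|) (crossing_test g) (crossing_coef g) u l x
    ((-1) ^+ (~~ b) *: h) (i, j) (fun k => normr_ge0 _) l0 lef Ex.
  rewrite /crossing_test /= gi gj => /(_ isT xi xj); rewrite pair_form2 /= !evZ => ge.
  have {ge} : 0 <= - ev g j * ((-1) ^+ (~~ b) * ev h i) + ev g i * ((-1) ^+ (~~ b) * ev h j).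
    apply: ge => k xk /eqP; rewrite normr_eq0 => /eqP gk.
    have := eK k xk gk; rewrite evZ; case: (b) => /=; rewrite ?expr0 ?expr1 ?mul1r ?mulN1r ?oppr_ge0 //.
    by rewrite oppr_le0.
  by case: (b) => /=; rewrite ?expr1 ?expr0; lra.
exists r => //; apply/eqP; rewrite -subr_eq0; apply/eqP; apply: sx => k xk.
by rewrite evD evN evZ (rE _ xk) subrr.
Qed.

End ConcreteSplits.

(** * Theorems of the alternative *)

Section Alternatives.
Variables (R : realType) (n : nat) (J : finType).
Implicit Types (F : {set J}) (v : J -> 'rV[R]_n) (b x : 'rV[R]_n).

(* Bartl's elimination of one generator at a time. *)
Lemma farkas F v b :
    (forall x, (forall k, k \in F -> 0 <= dotv (v k) x) -> 0 <= dotv b x) ->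
  exists2 t : J -> R, forall k, 0 <= t k & b = \sum_(k in F) t k *: v k.
Proof.
have [m] := ubnP #|F|; elim: m F v b => // m IHm F v b; rewrite ltnS => Fm.
have [-> b0|[i iF] Fb] := set_0Vmem F.
  exists (fun _ => 0) => //; rewrite big_set0; apply/rowP => k.
  have := b0 (- delta_mx 0 k); have := b0 (delta_mx 0 k).
  rewrite !dotv_delta -scaleN1r dotvZr dotv_delta mxE => h1 h2.
  apply/le_anti; rewrite h1 ?andbT; last by move=> j; rewrite inE.
  by rewrite -oppr_ge0 -mulN1r h2 // => j; rewrite inE.
have Fi : (#|F :\ i| < m)%N by apply: leq_trans Fm; rewrite [X in (_ < X)%N](cardsD1 i) iF.
have [bF|nbF] := pselect (forall x,
    (forall k, k \in F :\ i -> 0 <= dotv (v k) x) -> 0 <= dotv b x).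
  have [t t0 ->] := IHm _ _ _ Fi bF.
  exists (fun k => if k == i then 0 else t k); first by move=> k; case: ifP.
  rewrite [RHS](big_setD1 i iF) /= eqxx scale0r add0r.
  by apply: eq_bigr => k /setD1P [/negbTE ->].
have [y Fy by0] : exists2 y, (forall k, k \in F :\ i -> 0 <= dotv (v k) y) & dotv b y < 0.
  apply: contrapT => ny; apply: nbF => y Fy; rewrite leNgt; apply/negP => byn.
  by apply: ny; exists y.
have iy : dotv (v i) y < 0.
  rewrite ltNge; apply/negP => iy; move: by0; rewrite ltNge Fb // => k kF.
  by have [-> //|ki] := eqVneq k i; apply: Fy; rewrite !inE ki.
(* Subtracting [r b *: v i] from [b] is dual to moving [x] along [y] into the hyperplane orthogonal
   to [v i]. The signs of [y] on [b], [v i] and the other generators make the final coefficient of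
   [v i] nonnegative. *)
pose g := dotv (v i) y.
pose r b := dotv b y / g.
have [|t t0 bE] := IHm (F :\ i) (fun k => v k - r (v k) *: v i) (b - r b *: v i) Fi.
  move=> x Fx.
  have shift b' : dotv (b' - r b' *: v i) x = dotv b' (x - (dotv (v i) x / g) *: y).
    by rewrite dotvDl dotvNl dotvZl dotvDr dotvNr dotvZr /r; ring.
  rewrite shift; apply: Fb => k kF; have [->|ki] := eqVneq k i.
    by rewrite dotvDr dotvNr dotvZr -/g divfK ?lt_eqF // subrr.
  by rewrite -shift Fx // !inE ki.
exists (fun k => if k == i then r b - \sum_(k in F :\ i) t k * r (v k) else t k).
  move=> k; case: ifP => // _; rewrite subr_ge0; apply: (@le_trans _ _ 0).
    apply: sumr_le0 => j jF; rewrite mulr_ge0_le0 // /r mulr_ge0_le0 ?Fy //.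
    by rewrite invr_le0 ltW.
  by rewrite /r ltW // nmulr_rgt0 // invr_lt0.
rewrite (big_setD1 i iF) /= eqxx.
have -> : \sum_(k in F :\ i) (if k == i then r b - \sum_(k in F :\ i) t k * r (v k) else t k) *: v k
   = \sum_(k in F :\ i) t k *: v k.
  by apply: eq_bigr => k /setD1P [/negbTE ->].
rewrite -[LHS](subrK (r b *: v i)) bE.
have -> : \sum_(k in F :\ i) t k *: (v k - r (v k) *: v i) =
    \sum_(k in F :\ i) t k *: v k - (\sum_(k in F :\ i) t k * r (v k)) *: v i.
  by rewrite scaler_suml -sumrB; apply: eq_bigr => k _; rewrite scalerBr scalerA.
by rewrite scalerBl -addrA addrC [- _ + _]addrC.
Qed.

(** Farkas writes each [- v k] as a nonnegative combination; summing these relations over [k] gives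
    one with all coefficients at least 1. *)
Lemma stiemke F v :
    (forall x, (forall k, k \in F -> 0 <= dotv (v k) x) ->
       forall k, k \in F -> dotv (v k) x = 0) ->
  exists2 t : J -> R, forall k, 0 < t k & \sum_(k in F) t k *: v k = 0.
Proof.
move=> F0.
have /choice [t tP] : forall k, exists t : J -> R, k \in F ->
    (forall j, 0 <= t j) /\ - v k = \sum_(j in F) t j *: v j.
  move=> k; have [kF|_] := boolP (k \in F); last by exists (fun _ => 0).
  have [|t t0 tE] := @farkas F v (- v k); last by exists t.
  by move=> x Fx; rewrite dotvNl (F0 x Fx k kF) oppr0.
exists (fun j => 1 + \sum_(k in F) t k j).
  by move=> j; rewrite ltr_wpDr // sumr_ge0 // => k /tP [].
under eq_bigr do rewrite scalerDl scale1r scaler_suml.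
rewrite big_split /= exchange_big /= -big_split /= big1 // => k /tP [_ <-].
by rewrite subrr.
Qed.

End Alternatives.

(** * Faces, relative interiors and 2-splits *)

Section Subdivisions.
Variables (R : realType) (d : nat) (I : finType) (a : I -> 'rV[R]_d).
Implicit Types (F G K : {set I}) (S T : {set {set I}}) (z : 'rV[R]_(1 + d)).
Implicit Types (x y : 'rV[R]_d) (k : I) (t : I -> R).

Local Notation ev := (ev a).
Local Notation evp y x := (dotv (row_mx 1%:M y) x).

Lemma evp_row x (s : R) (c : 'rV[R]_d) : evp x (row_mx s%:M c) = s + dotv c x.
Proof. by rewrite dotv_row_mx mul1r dotvC. Qed.

Lemma evp_affine (r : R) x y z : evp ((1 - r) *: x + r *: y) z = (1 - r) * evp x z + r * evp y z.
Proof.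
have [s [c ->]] := row_mx_surj z.
by rewrite !evp_row dotvDr !dotvZr; ring.
Qed.

Lemma conv_sub F G y : F \subset G -> conv a F y -> conv a G y.
Proof.
move=> FG /conv_comb [t [t0 tF t1 ->]]; apply/conv_comb; exists t; split=> // k kG.
by apply: tF; apply: contra kG => /(fintype.subsetP FG).
Qed.

Lemma conv_ev_ge0 F y z : conv a F y -> (forall k, k \in F -> 0 <= ev z k) ->
  0 <= evp y z.
Proof.
move=> /conv_comb [t [t0 tF t1 ->]] zF; rewrite evp_comb //.
apply: sumr_ge0 => k _; have [/zF zk|/tF ->] := boolP (k \in F); last by rewrite mul0r.
exact: mulr_ge0.
Qed.

Lemma conv_ev_eq0 F y z : conv a F y -> (forall k, k \in F -> ev z k = 0) ->
  evp y z = 0.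
Proof.
move=> /conv_comb [t [t0 tF t1 ->]] zF; rewrite evp_comb // big1 // => k _.
by have [/zF ->|/tF ->] := boolP (k \in F); rewrite ?mul0r ?mulr0.
Qed.

Lemma conv_point F k : k \in F -> conv a F (a k).
Proof.
move=> kF; apply/conv_comb; exists (fun i => (i == k)%:R); split.
- by move=> i; rewrite ler0n.
- by move=> i; apply: contraNeq; rewrite pnatr_eq0 eqb0 negbK => /eqP ->.
- by rewrite (bigD1 k) //= eqxx big1 ?addr0 // => i /negbTE ->.
- by rewrite (bigD1 k) //= eqxx scale1r big1 ?addr0 // => i /negbTE ->; rewrite scale0r.
Qed.

Lemma conv_segment F (r : R) x y : 0 <= r <= 1 -> conv a F x -> conv a F y ->
  conv a F ((1 - r) *: x + r *: y).
Proof.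
move=> /andP [r0 r1] /conv_comb [t [t0 tF t1 ->]] /conv_comb [s [s0 sF s1 ->]].
apply/conv_comb; exists (fun k => (1 - r) * t k + r * s k); split.
- by move=> k; rewrite addr_ge0 // mulr_ge0 // subr_ge0.
- by move=> k kF; rewrite tF // sF // !mulr0 addr0.
- by rewrite big_split /= -!mulr_sumr t1 s1; ring.
- rewrite !scaler_sumr -big_split /=; apply: eq_bigr => k _.
  by rewrite !scalerA -scalerDl.
Qed.

(** * Relative interiors of convex hulls *)

Lemma relint_extend (X : set 'rV[R]_d) x y : relint X x -> X y ->
  exists2 r, 0 < r & X ((1 - (- r)) *: x + (- r) *: y).
Proof.
move=> [Xx /nbhs_ballP [e /= e0 eX]] Xy.
(* [C] exceeds every coordinate of [x - y] in absolute value, so the step [e / C] stays within the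
   ball of radius [e]. *)
pose C := 1 + \sum_k `|(x - y) 0 k|.
have C0 : 0 < C by rewrite ltr_wpDr // sumr_ge0.
have r0 : 0 < e / C by rewrite divr_gt0.
exists (e / C) => //; apply: eX; last first.
  exists 2, (fun i => if i == 0 then x else y), (fun i => if i == 0 then 1 - - (e / C) else - (e / C)).
  split; first by move=> i; case: ifP.
    by rewrite !big_ord_recl big_ord0 /=; ring.
  by rewrite !big_ord_recl big_ord0 /= addr0.
split=> // i k; rewrite ord1 /ball /= !mxE.
have -> : x 0 k - ((1 - - (e / C)) * x 0 k + - (e / C) * y 0 k) = - (e / C * (x - y) 0 k).
  by rewrite !mxE; ring.
rewrite normrN normrM gtr0_norm // mulrAC ltr_pdivrMr // ltr_pM2l // /C.
rewrite (bigD1 k) //=; set q := \sum_(_ | _) _.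
have : 0 <= q by rewrite sumr_ge0.
lra.
Qed.

(** If [z] were positive at [a k], prolonging the segment from [a k] slightly beyond [x] would make
    it negative inside the hull. *)
Lemma relint_ev_eq0 F x z : relint (conv a F) x ->
    (forall k, k \in F -> 0 <= ev z k) -> evp x z = 0 ->
  forall k, k \in F -> ev z k = 0.
Proof.
move=> Fx zF xz k kF; have [r r0] := relint_extend Fx (conv_point kF).
move=> /conv_ev_ge0 /(_ zF); rewrite evp_affine xz mulr0 add0r.
rewrite mulNr oppr_ge0 pmulr_rle0 // => zk.
by apply/le_anti; rewrite zk zF.
Qed.

Lemma relint_positive_comb F t : (forall k, k \in F -> 0 < t k) ->
    (forall k, k \notin F -> t k = 0) -> \sum_k t k = 1 ->
  relint (conv a F) (\sum_k t k *: a k).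
Proof.
move=> tF tF0 t1; set x := \sum_k _.
have xF : conv a F x.
  apply/conv_comb; exists t; split=> // k.
  by have [/tF/ltW|/tF0 ->] := boolP (k \in F).
split=> //.
(* Near x, the affine hull is covered by combinations of the a_k - x with
   small coefficients, since a pseudo-inverse of M is bounded. *)
pose M : 'M[R]_(#|I|, d) := \matrix_i
  (if enum_val i \in F then a (enum_val i) - x else 0).
pose N := pinvmx M.
have [k0 k0F] : exists k, k \in F.
  apply: contrapT => F0; have /eqP := t1; rewrite big1 ?(eq_sym 0) ?oner_eq0 // => k _.
  by apply: tF0; apply/negP => kF; apply: F0; exists k.
have [m mF mmin] := @arg_minP _ _ _ k0 (mem F) t k0F.
have tm0 : 0 < t m by exact: tF.
have tm1 : t m <= 1.
  rewrite -t1 (bigD1 m) //= lerDl sumr_ge0 // => k _.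
  by have [/tF/ltW|/tF0 ->] := boolP (k \in F).
pose C := 1 + \sum_i \sum_j `|N j i|.
have C0 : 0 < C by rewrite ltr_wpDr // sumr_ge0 // => i _; rewrite sumr_ge0.
have e0 : 0 < t m / (2 * C) by rewrite divr_gt0 // mulr_gt0.
apply/nbhs_ballP; exists (t m / (2 * C)) => //= y [_ ball_y] aff_y.
have convM (p : 'rV[R]_d) : conv a F p -> (p - x <= M)%MS.
  move=> /conv_comb [s [_ sF s1 ->]].
  have -> : \sum_k s k *: a k - x = \sum_k s k *: (a k - x).
    under [RHS]eq_bigr do rewrite scalerBr.
    by rewrite sumrB -scaler_suml s1 scale1r.
  apply: summx_sub => k _; have [kF|/sF ->] := boolP (k \in F); last first.
    by rewrite scale0r sub0mx.
  apply: scalemx_sub; have <- : row (enum_rank k) M = a k - x.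
    by rewrite rowK enum_rankK kF.
  exact: row_sub.
have yM : (y - x <= M)%MS.
  have [n [p [s [Xz s1 ->]]]] := aff_y.
  have -> : \sum_l s l *: p l - x = \sum_l s l *: (p l - x).
    under [RHS]eq_bigr do rewrite scalerBr.
    by rewrite sumrB -scaler_suml s1 scale1r.
  by apply: summx_sub => l _; apply: scalemx_sub; apply: convM.
pose s := (y - x) *m N.
have sE : y - x = \sum_i s 0 i *: row i M by rewrite -mulmx_sum_row mulmxKpV.
pose u k := if k \in F then s 0 (enum_rank k) else 0.
have uE : y - x = \sum_k u k *: (a k - x).
  rewrite sE [RHS](reindex _ (onW_bij _ (enum_val_bij I))) /=.
  apply: eq_bigr => i _; rewrite rowK /u; case: ifP => _; last by rewrite scaler0 scale0r.
  by rewrite enum_valK.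
have su : \sum_k `|u k| <= t m / 2.
  rewrite (reindex _ (onW_bij _ (enum_val_bij I))) /=.
  apply: (@le_trans _ _ (\sum_i \sum_j (t m / (2 * C)) * `|N j i|)).
    apply: ler_sum => i _; apply: (@le_trans _ _ `|s 0 i|).
      by rewrite /u enum_valK; case: ifP => // _; rewrite normr0.
    rewrite mxE; apply: le_trans (ler_norm_sum _ _ _) _; apply: ler_sum => j _.
    rewrite normrM ler_wpM2r // !mxE ltW // distrC; exact: ball_y.
  under eq_bigr do rewrite -mulr_sumr.
  rewrite -mulr_sumr invfM mulrA -mulrA ler_piMr ?divr_ge0 ?(ltW tm0) //.
  by rewrite mulrC ler_pdivrMr // mul1r /C lerDr.
have uk k : - (t m / 2) <= u k.
  rewrite lerNl; apply: le_trans su; rewrite (bigD1 k) //=.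
  by apply: ler_wpDr; rewrite ?sumr_ge0 // -normrN ler_norm.
have us : \sum_k u k <= t m / 2.
  by apply: le_trans su; apply: ler_sum => k _; exact: ler_norm.
(* These coefficients come from expanding [x] in [y = x + \sum_k u k *: (a k - x)]. The bounds by
   [t m / 2] keep them nonnegative. *)
apply/conv_comb; exists (fun k => (1 - \sum_k u k) * t k + u k); split.
- move=> k; have [kF|kF] := boolP (k \in F); last by rewrite tF0 // /u (negbTE kF) mulr0 addr0.
  have := mmin k kF; have := uk k => uk1 mk.
  have : (1 / 2) * t k <= (1 - \sum_k u k) * t k by rewrite ler_wpM2r ?(ltW (tF _ kF)) //; lra.
  lra.
- by move=> k kF; rewrite tF0 // /u (negbTE kF) mulr0 addr0.
- by rewrite big_split /= -mulr_sumr t1; ring.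
- rewrite -[LHS](subrK x) uE; under eq_bigr do rewrite scalerBr.
  under [RHS]eq_bigr do rewrite scalerDl -scalerA.
  rewrite sumrB big_split /= -scaler_suml -scaler_sumr -/x scalerBl scale1r.
  by rewrite addrC addrA addrAC.
Qed.

(** * Faces *)

Definition face_of F z : {set I} := [set k in F | ev z k == 0]%SET.

Lemma is_faceP F G :
  is_face a F G <-> exists2 z, forall k, k \in F -> 0 <= ev z k & G = face_of F z.
Proof.
split=> [[c [g [cF ->]]]|[z zF ->]].
  exists (row_mx (- g)%:M c) => [k kF|]; first by rewrite ev_row addrC subr_ge0 cF.
  by apply/setP => k; rewrite !inE ev_row addrC subr_eq0.
have [s [c zE]] := row_mx_surj z; exists c, (- s); split.
  by move=> k kF; rewrite -subr_ge0 opprK addrC -ev_row -zE zF.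
by apply/setP => k; rewrite !inE zE ev_row addrC -[in RHS]subr_eq0 opprK.
Qed.

Lemma face_refl F : is_face a F F.
Proof.
apply/is_faceP; exists 0 => [k _|]; first by rewrite ev0.
by apply/setP => k; rewrite inE ev0 eqxx andbT.
Qed.

Lemma face_sub F G : is_face a F G -> G \subset F.
Proof. by move=> [c [g [_ ->]]]; apply/fintype.subsetP => k; rewrite inE => /andP []. Qed.

(** A small multiple of [z'] only breaks ties on the face cut out by [z]. *)
Lemma face_perturb F z z' : (forall k, k \in F -> 0 <= ev z k) ->
    (forall k, k \in face_of F z -> 0 <= ev z' k) ->
  exists2 r, 0 < r & (forall k, k \in F -> 0 <= ev (z + r *: z') k) /\
    face_of F (z + r *: z') = face_of (face_of F z) z'.
Proof.
move=> zF z'F.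
pose s k := if k \in F then ev z k else 0; pose e k := if k \in F then ev z' k else 0.
have [||r r0 rP] := @small_step R I s e.
- by move=> k; rewrite /s; case: ifP => // /zF.
- move=> k; rewrite /s /e; case: ifP => // kF zk.
  by apply: z'F; rewrite inE kF zk eqxx.
have rF k : k \in F -> 0 <= ev z k + r * ev z' k.
  by move=> kF; have := rP k; rewrite /s /e kF.
(* Halving the step keeps points with positive [ev z] strictly positive. *)
have r20 : 0 < r / 2 by rewrite divr_gt0.
exists (r / 2) => //; split.
  by move=> k kF; rewrite evD evZ; have := rF k kF; have := zF k kF; lra.
apply/setP => k; rewrite !inE evD evZ; have [kF|//] := boolP (k \in F); rewrite /=.
have [zk|zk] := eqVneq (ev z k) 0.
  by rewrite zk add0r mulf_eq0 gt_eqF.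
rewrite /= gt_eqF //; have := rF k kF; have := zF k kF; rewrite le_eqVlt eq_sym (negbTE zk) /=.
lra.
Qed.

Lemma face_trans F G K : is_face a F G -> is_face a G K -> is_face a F K.
Proof.
move=> /is_faceP [z zF ->] /is_faceP [z' zG ->].
have [r _ [rF rE]] := face_perturb zF zG.
by apply/is_faceP; exists (z + r *: z').
Qed.

Lemma conv_face_comb F z (t : I -> R) : (forall k, 0 <= t k) ->
    (forall k, k \notin F -> t k = 0) -> \sum_k t k = 1 ->
    (forall k, k \in F -> 0 <= ev z k) ->
    evp (\sum_k t k *: a k) z = 0 ->
  forall k, t k != 0 -> k \in face_of F z.
Proof.
move=> t0 tF t1 zF; rewrite evp_comb // => tz k tk.
have kF : k \in F by apply: contraNT tk => /tF ->.
have pos j : 0 <= t j * ev z j.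
  by have [/zF zj|/tF ->] := boolP (j \in F); [exact: mulr_ge0|rewrite mul0r].
move/eqP: tz; rewrite psumr_eq0 // => /allP /(_ k (mem_index_enum k)) /=.
by rewrite mulf_eq0 (negbTE tk) inE kF.
Qed.

(** In a smallest face containing [y], an affine function that is nonnegative on the face and zero
    at [y] vanishes on the face, or it would cut out a smaller one. Stiemke then makes [y] a
    strictly positive combination. *)
Lemma conv_relint_face F y : conv a F y ->
  exists2 G, is_face a F G & relint (conv a G) y.
Proof.
move=> Fy.
pose P n := `[< exists z, [/\ forall k, k \in F -> 0 <= ev z k, evp y z = 0
   & #|face_of F z| = n] >].
have exP : exists n, P n.
  exists #|face_of F 0|; apply/asboolP; exists 0; split=> //; last exact: dotv0r.
  by move=> k _; rewrite ev0.
case: (ex_minnP exP) => n /asboolP [z [zF yz zn]] nmin.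
exists (face_of F z); first by apply/is_faceP; exists z.
have [|t t0 t0E] := @stiemke R (1 + d) I (face_of F z)
   (fun k => row_mx 1%:M (a k) - row_mx 1%:M y).
  move=> x xG k kG.
  (* The constant term is shifted to make the function vanish at [y]. *)
  pose z' := x - row_mx (evp y x)%:M 0.
  have z'E j : ev z' j = dotv (row_mx 1%:M (a j) - row_mx 1%:M y) x.
    by rewrite evD evN ev_row dotv0l addr0 dotvDl dotvNl.
  have yz' : evp y z' = 0.
    by rewrite dotvDr dotvNr evp_row dotv0l addr0 subrr.
  have [|r r0 [rF rE]] := @face_perturb F z z' zF; first by move=> j /xG; rewrite z'E.
  have : P #|face_of F (z + r *: z')|.
    by apply/asboolP; exists (z + r *: z'); split=> //; rewrite dotvDr dotvZr yz yz' mulr0 addr0.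
  move=> /nmin; rewrite rE -zn => le.
  have sub : face_of (face_of F z) z' \subset face_of F z.
    by apply/fintype.subsetP => j; rewrite inE => /andP [].
  have /eqP GE : face_of (face_of F z) z' == face_of F z by rewrite eqEcard sub le.
  by move: kG; rewrite -GE inE z'E => /andP [_ /eqP].
have /conv_comb [s [s0 sF s1 yE]] := Fy.
pose m := \sum_(k in face_of F z) t k.
have [k1 k1G] : exists k, k \in face_of F z.
  have [k sk] : exists k, s k != 0.
    apply: contrapT => ns; move/eqP: s1; rewrite big1 ?(eq_sym 0) ?oner_eq0 // => k _.
    by apply/eqP; apply: contrapT => sk; apply: ns; exists k; apply/negP.
  exists k; apply: conv_face_comb sk => //; by rewrite -yE.
have m0 : 0 < m.
  by rewrite /m (bigD1 k1) //= ltr_pwDl // sumr_ge0 // => k _; exact: ltW.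
have row_eq : \sum_(k in face_of F z) t k *: (a k - y) = 0.
  have := congr1 (fun u : 'rV_(1 + d) => rsubmx u) t0E; rewrite linear0 linear_sum /= => E.
  rewrite -[RHS]E; apply: eq_bigr => k _.
  by rewrite opp_row_mx add_row_mx scale_row_mx row_mxKr.
have -> : y = \sum_k (if k \in face_of F z then t k / m else 0) *: a k.
  rewrite [RHS](bigID (mem (face_of F z))) /= [X in _ + X]big1 ?addr0; last first.
    by move=> k /negbTE ->; rewrite scale0r.
  under [RHS]eq_bigr => k kG do rewrite kG mulrC -scalerA.
  rewrite -scaler_sumr; move: row_eq; under eq_bigr do rewrite scalerBr.
  rewrite sumrB -scaler_suml => /eqP; rewrite subr_eq0 => /eqP ->.
  by rewrite scalerA mulVf ?scale1r // gt_eqF.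
apply: relint_positive_comb.
- by move=> k kG; rewrite kG divr_gt0.
- by move=> k /negbTE ->.
- rewrite -big_mkcond /= -mulr_suml divff // gt_eqF //.
Qed.

Lemma relint_neq0 F : F != finset.set0 -> exists y, relint (conv a F) y.
Proof.
move=> /set0Pn [k kF].
have F0 : 0 < #|F|%:R :> R by rewrite ltr0n; apply/card_gt0P; exists k.
exists (\sum_k (if k \in F then #|F|%:R^-1 else 0) *: a k).
apply: relint_positive_comb.
- by move=> j ->; rewrite invr_gt0.
- by move=> j /negbTE ->.
- by rewrite -big_mkcond /= sumr_const -(mulr_natr (_^-1)) mulVf // gt_eqF.
Qed.

(** * Subdivision by a hyperplane, and the hyperplane of a 2-split *)

Lemma side_subdivision z :
    (forall y, conv a [set: I] y ->
       conv a (pos_side a z) y \/ conv a (neg_side a z) y) ->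
  is_subdivision a (faces a (pos_side a z) :|: faces a (neg_side a z)).
Proof.
move=> cover.
have inT K : K \in faces a (pos_side a z) :|: faces a (neg_side a z) <->
    is_face a (pos_side a z) K \/ is_face a (neg_side a z) K.
  by rewrite !inE; split=> [/orP [/asboolP|/asboolP]|[|] /asboolP ->]; rewrite ?orbT //; [left|right].
split.
- move=> F G /inT FT FG; apply/inT.
  by case: FT => FT; [left|right]; apply: face_trans FG.
- apply/seteqP; split=> [y [F /= _]|y]; first exact: conv_sub (finset.subsetT _).
  move=> /cover [yF|yF].
    by exists (pos_side a z) => //=; apply/inT; left; exact: face_refl.
  by exists (neg_side a z) => //=; apply/inT; right; exact: face_refl.
have same A F G x : is_face a A G -> F \subset A ->
    relint (conv a F) x -> relint (conv a G) x -> F \subset G.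
  move=> /is_faceP [c cA ->] FA Fx [Gx _]; apply/fintype.subsetP => k kF.
  rewrite inE (fintype.subsetP FA _ kF) /=; apply/eqP.
  apply: (relint_ev_eq0 Fx) kF; first by move=> j /(fintype.subsetP FA); apply: cA.
  by apply: (conv_ev_eq0 Gx) => j; rewrite inE => /andP [_ /eqP].
(* A common point of faces from opposite sides lies on [z = 0]; being relatively interior, it forces
   both faces into [z = 0], hence into both sides, where [same] applies. *)
have cross F G x : is_face a (pos_side a z) F -> is_face a (neg_side a z) G ->
    relint (conv a F) x -> relint (conv a G) x -> F = G.
  move=> pF nG Fx Gx.
  have Fpos := face_sub pF; have Gneg := face_sub nG.
  have Fz k : k \in F -> 0 <= ev z k by move=> /(fintype.subsetP Fpos); rewrite inE.
  have Gz k : k \in G -> 0 <= ev (- z) k.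
    by move=> /(fintype.subsetP Gneg); rewrite inE evN oppr_ge0.
  have xz : evp x z = 0.
    have := conv_ev_ge0 Fx.1 Fz; have := conv_ev_ge0 Gx.1 Gz; rewrite dotvNr; lra.
  have F0 := relint_ev_eq0 Fx Fz xz.
  have G0 k : k \in G -> ev z k = 0.
    move=> kG; apply/eqP; rewrite -oppr_eq0 -evN; apply/eqP.
    by apply: (relint_ev_eq0 Gx Gz) kG; rewrite dotvNr xz oppr0.
  apply/eqP; rewrite finset.eqEsubset; apply/andP; split.
    by apply: same nG _ Fx Gx; apply/fintype.subsetP => k /F0 k0; rewrite inE k0.
  by apply: same pF _ Gx Fx; apply/fintype.subsetP => k /G0 k0; rewrite inE k0.
move=> F G /inT FT /inT GT /eqP FG; apply/seteqP; split=> // x [Fx Gx]; apply: FG.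
have eqF A : is_face a A F -> is_face a A G -> F = G.
  move=> AF AG; apply/eqP; rewrite finset.eqEsubset.
  by rewrite (same A F G x) ?(same A G F x) // face_sub.
case: FT GT => FT [] GT; [exact: eqF FT GT|exact: cross FT GT Fx Gx| |exact: eqF FT GT].
by apply/esym; exact: cross GT FT Gx Fx.
Qed.

Lemma sub_maximal_face S K : K \in S ->
  exists2 F, F \in maximal_faces S & K \subset F.
Proof.
move=> KS; pose P F := (F \in S) && (K \subset F).
have PK : P K by rewrite /P KS subxx.
case: (arg_maxnP (fun F : {set I} => #|F|) PK) => F /andP [FS KF] Fmax.
exists F => //; rewrite inE FS; apply/forall_inP => G GS; apply/implyP => FG.
rewrite eq_sym eqEcard FG; apply: Fmax; rewrite /P GS.
exact: fintype.subset_trans KF FG.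
Qed.

(* Points of conv A near the relative interior of conv G but off the hyperplane
   z = 0 are covered by conv F only, so conv F contains a point of relint conv G. *)
Lemma flat_face_sub S F G z i : is_subdivision a S -> F \in S -> G \in S ->
    (forall K, K \in S -> K \subset F \/ K \subset G) -> G != finset.set0 ->
    (forall k, k \in G -> ev z k = 0) -> 0 < ev z i ->
  G \subset F.
Proof.
move=> [Sface Scov Srel] FS GS SFG G0 zG zi.
have [b Gb] := relint_neq0 G0; have [cGb _] := Gb.
have bz := conv_ev_eq0 cGb zG.
have Fb : conv a F b.
  have [FP|nFP] := pselect (forall x : 'rV[R]_(1 + d),
      (forall k, k \in F -> 0 <= ev x k) -> 0 <= evp b x).
    have [t t0 bE] := @farkas R (1 + d) I F (fun k => row_mx 1%:M (a k)) _ FP.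
    pose s k := if k \in F then t k else 0.
    have sE : row_mx 1%:M b = \sum_k s k *: row_mx 1%:M (a k) :> 'rV[R]_(1 + d).
      rewrite bE (big_mkcond (mem F)) /=; apply: eq_bigr => k _.
      by rewrite /s; case: ifP => // _; rewrite scale0r.
    apply/conv_comb; exists s; split.
    - by move=> k; rewrite /s; case: ifP.
    - by move=> k /negbTE kF; rewrite /s kF.
    - have := congr1 (fun u : 'rV[R]_(1 + d) => lsubmx u 0 0) sE.
      rewrite row_mxKl !mxE eqxx summxE => /esym sum1; apply: etrans sum1.
      by apply: eq_bigr => k _; rewrite mxE row_mxEl mxE eqxx mulr1.
    - have := congr1 (fun u : 'rV[R]_(1 + d) => rsubmx u) sE.
      rewrite row_mxKr linear_sum /= => ->.
      by apply: eq_bigr => k _; rewrite scale_row_mx row_mxKr.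
  exfalso; apply: nFP => x xF; rewrite leNgt; apply/negP => bx.
  pose p := - evp b x; have p0 : 0 < p by rewrite oppr_gt0.
  pose q := `|ev x i|; have q0 : 0 <= q by exact: normr_ge0.
  (* For this [r] the point at fraction [r] from [b] to [a i] still has [x] at most [- p / 2], so no
     cell inside [F] covers it; [z > 0] there rules out cells inside [G]. *)
  pose r := p / (2 * (p + q)).
  have pq0 : 0 < p + q by rewrite ltr_pwDl.
  have r0 : 0 < r by rewrite divr_gt0 // mulr_gt0.
  have rpq : r * (p + q) = p / 2 by rewrite /r invfM mulrA divfK // gt_eqF.
  have r1 : r <= 1.
    rewrite /r ler_pdivrMr ?mulr_gt0 // mul1r; lra.
  have bA : conv a [set: I] b by exact: conv_sub (finset.subsetT _) cGb.
  have iA : conv a [set: I] (a i) by exact: conv_point.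
  have : conv a [set: I] ((1 - r) *: b + r *: a i).
    by apply: conv_segment => //; rewrite (ltW r0).
  rewrite -Scov => -[K /= KS Ky]; case: (SFG K KS) => KX.
    have := conv_ev_ge0 (conv_sub KX Ky) xF; rewrite evp_affine.
    have xi : ev x i <= q by exact: ler_norm.
    have := ler_wpM2l (ltW r0) xi; rewrite /p in rpq p0 *.
    rewrite -/(ev x i); lra.
  have := conv_ev_eq0 (conv_sub KX Ky) zG; rewrite evp_affine bz mulr0 add0r => /eqP.
  by rewrite mulf_eq0 (gt_eqF r0) gt_eqF.
(* [G] and the face [F'] of [F] share a relatively interior point, so they coincide. *)
have [F' FF' F'b] := conv_relint_face Fb.
have F'S := Sface _ _ FS FF'.
have [->|GF'] := eqVneq G F'; first exact: face_sub.
have := Srel _ _ GS F'S GF'; move/seteqP => -[/(_ b) H _].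
by case: H.
Qed.

(** Without a separating function, Stiemke applied to the lifted points of [F] and the negated
    lifted points of [G] gives a strictly positive relation; normalized, it is a common relatively
    interior point. *)
Lemma separate_relint F G : F != finset.set0 ->
    relint (conv a F) `&` relint (conv a G) = set0 ->
  exists z, [/\ forall k, k \in F -> 0 <= ev z k, forall k, k \in G -> ev z k <= 0
    & exists2 k, k \in F :|: G & ev z k != 0].
Proof.
move=> /set0Pn [k0 k0F] FG0; apply: contrapT => nsep.
pose A : {set I * bool} := [set kb | if kb.2 then kb.1 \in G else kb.1 \in F]%SET.
pose v (kb : I * bool) : 'rV[R]_(1 + d) := (-1) ^+ kb.2 *: row_mx 1%:M (a kb.1).
have vE k (b : bool) (x : 'rV[R]_(1 + d)) : dotv (v (k, b)) x = if b then - ev x k else ev x k.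
  by rewrite /v dotvZl; case: b; rewrite ?expr1 ?expr0 ?mulN1r ?mul1r.
have [|t t0 tE] := @stiemke R (1 + d) _ A v.
  move=> x xA [k b] kA; apply: contrapT => xk; apply: nsep; exists x; split.
  - by move=> j jF; have := xA (j, false); rewrite vE; apply; rewrite inE.
  - move=> j jG; rewrite -oppr_ge0; have := xA (j, true); rewrite vE; apply.
    by rewrite inE.
  - exists k; first by move: kA; rewrite !inE /=; case: (b) => ->; rewrite ?orbT.
    by apply: contra_notN xk => /eqP xk; rewrite vE xk oppr0; case: (b).
pose tF k := if k \in F then t (k, false) else 0.
pose tG k := if k \in G then t (k, true) else 0.
have rowE : \sum_k tF k *: row_mx 1%:M (a k) = \sum_k tG k *: row_mx 1%:M (a k) :> 'rV[R]_(1 + d).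
  have sum0 : \sum_k \sum_b (if (k, b) \in A then t (k, b) *: v (k, b) else 0) = 0.
    rewrite pair_bigA /= -[RHS]tE [RHS]big_mkcond; by apply: eq_bigr => -[k b] _.
  apply/eqP; rewrite -subr_eq0 -[X in _ == X]sum0 -sumrB; apply/eqP.
  apply: eq_bigr => k _.
  rewrite big_bool /= !inE /= /tF /tG /v /= expr1 expr0 scale1r scaleN1r scalerN addrC.
  by congr (_ + _); case: ifP; rewrite ?scale0r ?oppr0.
pose m := \sum_k tF k.
have mG : \sum_k tG k = m.
  have := congr1 (fun u : 'rV[R]_(1 + d) => lsubmx u 0 0) rowE; rewrite !mxE !summxE => E.
  transitivity (\sum_k (tG k *: row_mx 1%:M (a k) : 'rV[R]_(1 + d)) 0 (lshift d 0)).
    by apply: eq_bigr => k _; rewrite mxE row_mxEl mxE eqxx mulr1.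
  by rewrite -E; apply: eq_bigr => k _; rewrite mxE row_mxEl mxE eqxx mulr1.
have pE : \sum_k tF k *: a k = \sum_k tG k *: a k.
  have := congr1 (fun u : 'rV[R]_(1 + d) => rsubmx u) rowE; rewrite !linear_sum /= => E.
  transitivity (\sum_k rsubmx (tF k *: row_mx 1%:M (a k) : 'rV[R]_(1 + d))).
    by apply: eq_bigr => k _; rewrite scale_row_mx row_mxKr.
  by rewrite E; apply: eq_bigr => k _; rewrite scale_row_mx row_mxKr.
have m0 : 0 < m.
  rewrite /m (bigD1 k0) //= ltr_pwDl // /tF ?k0F // sumr_ge0 // => k _.
  by case: ifP => // _; exact: ltW.
have normE (s : I -> R) : \sum_k (s k / m) *: a k = m^-1 *: \sum_k s k *: a k.
  by rewrite scaler_sumr; apply: eq_bigr => k _; rewrite scalerA mulrC.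
have Fx : relint (conv a F) (\sum_k (tF k / m) *: a k).
  apply: relint_positive_comb => [k kF|k /negbTE kF|].
  - by rewrite /tF kF divr_gt0.
  - by rewrite /tF kF mul0r.
  - by rewrite -mulr_suml divff // gt_eqF.
have Gx : relint (conv a G) (\sum_k (tG k / m) *: a k).
  apply: relint_positive_comb => [k kF|k /negbTE kF|].
  - by rewrite /tG kF divr_gt0.
  - by rewrite /tG kF mul0r.
  - by rewrite -mulr_suml mG divff // gt_eqF.
have : (relint (conv a F) `&` relint (conv a G)) (\sum_k (tF k / m) *: a k).
  by split=> //; rewrite normE pE -normE.
by rewrite FG0.
Qed.

Lemma maximal_facesP S F : F \in maximal_faces S ->
  F \in S /\ forall G, G \in S -> F \subset G -> G = F.
Proof.
rewrite inE => /andP [FS /forall_inP Fmax]; split=> // G GS FG.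
by have /implyP/(_ FG)/eqP := Fmax G GS.
Qed.

Lemma two_split_hyperplane S : is_2split a S -> exists h, induces_2split a h S.
Proof.
move=> [[Ssub Sntriv Scoarse] /eqP /cards2P [F [G [FG SE]]]].
have [FS Fmax] : F \in S /\ forall K, K \in S -> F \subset K -> K = F.
  by apply: maximal_facesP; rewrite SE !inE eqxx.
have [GS Gmax] : G \in S /\ forall K, K \in S -> G \subset K -> K = G.
  by apply: maximal_facesP; rewrite SE !inE eqxx orbT.
have SFG K : K \in S -> K \subset F \/ K \subset G.
  move=> /sub_maximal_face [M]; rewrite SE !inE => /orP [] /eqP -> KM; by [left|right].
have nFG : ~ F \subset G by move=> /(Fmax _ GS) E; rewrite E eqxx in FG.
have nGF : ~ G \subset F by move=> /(Gmax _ FS) E; rewrite E eqxx in FG.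
have F0 : F != finset.set0 by apply: contra_notN nFG => /eqP ->; exact: finset.sub0set.
have G0 : G != finset.set0 by apply: contra_notN nGF => /eqP ->; exact: finset.sub0set.
have [Sface Scov Srel] := Ssub.
have [z [zF zG [k0 _ k0z]]] := separate_relint F0 (Srel _ _ FS GS FG).
have Fpos : F \subset pos_side a z by apply/fintype.subsetP => k /zF; rewrite inE.
have Gneg : G \subset neg_side a z by apply/fintype.subsetP => k /zG; rewrite inE.
(* Otherwise [F] lies in [z = 0] and [flat_face_sub] puts it inside [G]; the negative side is
   symmetric. *)
have [i zi] : exists i, 0 < ev z i.
  apply: contrapT => ni.
  have neg k : ev z k <= 0 by rewrite leNgt; apply/negP => zk; apply: ni; exists k.
  apply: nFG; apply: (@flat_face_sub S G F (- z) k0) => //.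
  - by move=> K /SFG []; [right|left].
  - by move=> k kF; apply/eqP; rewrite evN oppr_eq0 eq_le neg zF.
  - by rewrite evN oppr_gt0 lt_neqAle k0z neg.
have [j zj] : exists j, ev z j < 0.
  apply: contrapT => nj.
  have pos k : 0 <= ev z k by rewrite leNgt; apply/negP => zk; apply: nj; exists k.
  apply: nGF; apply: (@flat_face_sub S F G z k0) => //.
  - by move=> k kG; apply/eqP; rewrite eq_le pos zG.
  - by rewrite lt_def k0z pos.
have cover y : conv a [set: I] y -> conv a (pos_side a z) y \/ conv a (neg_side a z) y.
  rewrite -Scov => -[K /= KS Ky]; have [KF|KG] := SFG K KS.
    by left; apply: conv_sub Ky; exact: fintype.subset_trans KF Fpos.
  by right; apply: conv_sub Ky; exact: fintype.subset_trans KG Gneg.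
set T := faces a (pos_side a z) :|: faces a (neg_side a z).
have posT : pos_side a z \in T by rewrite !inE; apply/orP; left; apply/asboolP; exact: face_refl.
have negT : neg_side a z \in T by rewrite !inE; apply/orP; right; apply/asboolP; exact: face_refl.
have Tsub K : K \in T -> K \subset pos_side a z \/ K \subset neg_side a z.
  by rewrite !inE => /orP [] /asboolP /face_sub; [left|right].
have iT : i \in pos_side a z by rewrite inE ltW.
have jT : j \in neg_side a z by rewrite inE ltW.
have iN : i \notin neg_side a z by rewrite inE -ltNge.
have jN : j \notin pos_side a z by rewrite inE -ltNge.
(* The subdivision by the sides coarsens [S] and is not trivial, since no cell contains both [i] and
   [j]. *)
have TE : T = S.
  have [|//|Ttriv] := Scoarse _ (side_subdivision cover).
    move=> K /SFG [KF|KG].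
      by exists (pos_side a z) => //; exact: fintype.subset_trans KF Fpos.
    by exists (neg_side a z) => //; exact: fintype.subset_trans KG Gneg.
  have : [set: I]%SET \in T by rewrite /T Ttriv inE; apply/asboolP; exact: face_refl.
  case/Tsub => /fintype.subsetP sub.
    by move: jN; rewrite sub ?inE.
  by move: iN; rewrite sub ?inE.
have maxE : maximal_faces S = [set pos_side a z; neg_side a z]%SET.
  rewrite -TE; apply/setP => K; rewrite !inE; apply/andP/orP.
    move=> [KT /forall_inP Kmax].
    have {}KT : K \in T by rewrite !inE.
    have [sub|sub] := Tsub K KT.
      by left; have /implyP/(_ sub) := Kmax _ posT; rewrite eq_sym.
    by right; have /implyP/(_ sub) := Kmax _ negT; rewrite eq_sym.
  move=> [/eqP ->|/eqP ->]; split.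
  - by move: posT; rewrite !inE.
  - apply/forall_inP => M MT; apply/implyP => sub; rewrite finset.eqEsubset sub andbT.
    have [//|sub'] := Tsub M MT.
    by move: iN; rewrite (fintype.subsetP sub') // (fintype.subsetP sub).
  - by move: negT; rewrite !inE.
  - apply/forall_inP => M MT; apply/implyP => sub; rewrite finset.eqEsubset sub andbT.
    have [sub'|//] := Tsub M MT.
    by move: jN; rewrite (fintype.subsetP sub') // (fintype.subsetP sub).
have [s [c zE]] := row_mx_surj z.
exists (c, - s); split=> /=.
  apply/eqP => c0; move: zi zj; rewrite zE !ev_row c0 !dotv0l; lra.
rewrite maxE; congr [set _; _]%SET; apply/setP => k; rewrite !inE zE ev_row.
  by rewrite -lerBlDl sub0r.
by rewrite addrC -lerBrDr sub0r.
Qed.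

(** * Regular subdivisions and their refinement of splits *)

Lemma in_regular_subdivision w F : F \in regular_subdivision a w <->
  exists2 z, envelope a w z & F = [set k | slack a w z k == 0]%SET.
Proof.
have lift_in i : lifted_polyhedron a w (row_mx (w i)%:M (a i)).
  exists (row_mx (w i)%:M (a i)).
    exists 1%N, (fun _ => row_mx (w i)%:M (a i)), (fun _ => 1); split=> //.
    - by rewrite big_ord1.
    - by rewrite big_ord1 scale1r.
  exists 0; last by rewrite addr0.
  by exists 0; rewrite /= ?lexx // -scalemx1 scale0r row_mx0.
rewrite inE; split=> [/asboolP [Q [[c0 [c [g [c0_gt0 sub QE]]]] FQ]]|[z Ez FE]].
  (* The supporting hyperplane of the lower face, scaled so that its normal has first coordinate
     1. *)
  pose z := row_mx (- g / c0)%:M (c0^-1 *: c).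
  have zE k : slack a w z k = (dotv (row_mx c0%:M c) (row_mx (w k)%:M (a k)) - g) / c0.
    rewrite /slack ev_row dotvZl dotv_row_mx; have c0n : c0 != 0 by rewrite gt_eqF.
    by field.
  exists z; first by apply/envelopeP => k; rewrite zE divr_ge0 ?(ltW c0_gt0) // subr_ge0; apply: sub.
  apply/setP => k; rewrite inE zE mulf_eq0 invr_eq0 (gt_eqF c0_gt0) orbF subr_eq0.
  apply/idP/eqP => [/FQ|kg]; first by rewrite QE => -[].
  by apply/FQ; rewrite QE; split.
have [s [c zE]] := row_mx_surj z; move/envelopeP: (Ez) => sz.
have slackE k : slack a w z k = dotv (row_mx 1%:M c) (row_mx (w k)%:M (a k)) + s.
  by rewrite zE /slack ev_row dotv_row_mx; ring.
apply/asboolP; eexists; split.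
  exists 1, c, (- s); split=> //.
  move=> _ [x [m [y [t [yr t0 t1 ->]]]] [_ [r /= r0 <-] <-]].
  rewrite /= dotvDr dotv_row_mx dotv0r mul1r addr0 dotv_sumr.
  apply: ler_wpDr => //; have -> : - s = \sum_k t k * - s by rewrite -mulr_suml t1 mul1r.
  apply: ler_sum => k _; rewrite dotvZr ler_wpM2l //; have [i _ <-] := yr k.
  by rewrite /= -subr_ge0 opprK -slackE.
move=> i; rewrite FE inE slackE addr_eq0; split=> [/eqP E|[_ /= ->] //].
by split.
Qed.

Lemma coarsens_split1 p w :
  coarsens (Defs.split1 a p) (regular_subdivision a w) <->
  refines a (point_test p) (@point_coef R I) w.
Proof.
rewrite refines1P; split=> [co z Ez|ref F /in_regular_subdivision [z Ez ->]].
  have [|G] := co [set k | slack a w z k == 0]%SET.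
    by apply/in_regular_subdivision; exists z.
  rewrite inE => /asboolP /face_sub Gp sub; apply/negP => zp.
  have := fintype.subsetP Gp p (fintype.subsetP sub p _).
  by rewrite !inE eqxx zp => /(_ isT).
exists [set~ p]%SET; first by rewrite inE; apply/asboolP; exact: face_refl.
by apply/fintype.subsetP => k; rewrite !inE; apply: contraTneq => ->; exact: ref.
Qed.

Lemma coarsens_sides S z w :
    maximal_faces S = [set pos_side a z; neg_side a z]%SET ->
  coarsens S (regular_subdivision a w) <-> refines a (crossing_test a z) (crossing_coef a z) w.
Proof.
move=> SE; rewrite refines2P; split=> [co x i j Ex zi zj xi xj|ref F].
  have [|G GS sub] := co [set k | slack a w x k == 0]%SET.
    by apply/in_regular_subdivision; exists x.
  have [M] := sub_maximal_face GS; rewrite SE !inE => ME GM.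
  have iM : i \in M by apply/(fintype.subsetP GM)/(fintype.subsetP sub); rewrite inE xi.
  have jM : j \in M by apply/(fintype.subsetP GM)/(fintype.subsetP sub); rewrite inE xj.
  case/orP: ME iM jM => /eqP ->; rewrite !inE; first by rewrite (leNgt 0 (ev z j)) zj.
  by rewrite (leNgt (ev z i)) zi.
move=> /in_regular_subdivision [x Ex ->].
have pS : pos_side a z \in S.
  suff /maximal_facesP [] : pos_side a z \in maximal_faces S by [].
  by rewrite SE !inE eqxx.
have nS : neg_side a z \in S.
  suff /maximal_facesP [] : neg_side a z \in maximal_faces S by [].
  by rewrite SE !inE eqxx orbT.
have [[j zj xj]|nj] := pselect (exists2 j, ev z j < 0 & slack a w x j = 0).
  exists (neg_side a z) => //; apply/fintype.subsetP => k; rewrite !inE => /eqP xk.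
  by rewrite leNgt; apply/negP => zk; exact: ref Ex zk zj xk xj.
exists (pos_side a z) => //; apply/fintype.subsetP => k; rewrite !inE => /eqP xk.
by rewrite leNgt; apply/negP => zk; apply: nj; exists k.
Qed.

(** Both open sides contain points: otherwise one maximal face would be the whole configuration and
    contain the other. *)
Lemma split_tests_sides S z : is_2split a S ->
    maximal_faces S = [set pos_side a z; neg_side a z]%SET ->
  split_tests a (fun k => `|ev z k|) (crossing_test a z) (crossing_coef a z).
Proof.
move=> [[[_ Scov _] _ _] card2] SE.
have [pS pmax] : pos_side a z \in S /\ forall G, G \in S -> pos_side a z \subset G -> G = pos_side a z.
  by apply: maximal_facesP; rewrite SE !inE eqxx.
have [nS nmax] : neg_side a z \in S /\ forall G, G \in S -> neg_side a z \subset G -> G = neg_side a z.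
  by apply: maximal_facesP; rewrite SE !inE eqxx orbT.
have pn : pos_side a z != neg_side a z.
  by apply/negP => pn; move: card2; rewrite SE cards2 pn.
apply: split_tests2.
- move=> y; rewrite -Scov => -[K /= KS Ky].
  have [M] := sub_maximal_face KS; rewrite SE !inE => /orP [] /eqP -> KM.
    by left; exact: conv_sub Ky.
  by right; exact: conv_sub Ky.
- apply: contrapT => ni; move/eqP: pn; apply; apply/esym/(pmax _ nS).
  apply/fintype.subsetP => k _; rewrite inE leNgt; apply/negP => zk.
  by apply: ni; exists k.
- apply: contrapT => nj; move/eqP: pn; apply; apply/(nmax _ pS).
  apply/fintype.subsetP => k _; rewrite inE leNgt; apply/negP => zk.
  by apply: nj; exists k.
Qed.

(** Every cell lies in a maximal one, so [S] coarsens [T]; as [T] is coarsest and [S] is nontrivial,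
    they agree. *)
Lemma eq_maximal_faces_2split S T : is_2split a S -> is_2split a T ->
  maximal_faces S = maximal_faces T -> S = T.
Proof.
move=> [[Ssub Sntriv _] _] [[_ _ Tco] _] ST.
have [|//|//] := Tco S Ssub.
move=> K /sub_maximal_face [M]; rewrite -ST => /maximal_facesP [MS _] KM.
by exists M.
Qed.

Lemma sides_scale (r : R) z : r != 0 ->
  [set pos_side a (r *: z); neg_side a (r *: z)]%SET =
  [set pos_side a z; neg_side a z]%SET.
Proof.
move=> r0; have [rpos|rneg|/eqP] := ltrgt0P r; last by rewrite (negbTE r0).
  congr [set _; _]%SET; apply/setP => k; rewrite !inE evZ.
    by rewrite pmulr_rge0.
  by rewrite pmulr_rle0.
rewrite finset.setUC; congr [set _; _]%SET; apply/setP => k; rewrite !inE evZ.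
  by rewrite nmulr_rle0.
by rewrite nmulr_rge0.
Qed.

Definition equation_vector (h : 'rV[R]_d * R) : 'rV[R]_(1 + d) := row_mx (- h.2)%:M h.1.

Lemma weight2E h k : weight2 a h k = `|ev (equation_vector h) k|.
Proof. by rewrite ev_row addrC. Qed.

Lemma induces_2split_sides h S : induces_2split a h S ->
  maximal_faces S =
    [set pos_side a (equation_vector h); neg_side a (equation_vector h)]%SET.
Proof.
move=> [_ ->]; congr [set _; _]%SET; apply/setP => k; rewrite !inE ev_row addrC.
  by rewrite subr_ge0.
by rewrite subr_le0.
Qed.

End Subdivisions.

Lemma in_minkowski_sums (R : realType) (n : nat) (K : eqType) (r : seq K)
    (X : K -> set 'rV[R]_n) x : uniq r ->
  (\big[@minkowski_sum R n/[set 0]]_(j <- r) X j) x <->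
  exists2 y : K -> 'rV[R]_n, forall j, j \in r -> X j (y j) & x = \sum_(j <- r) y j.
Proof.
elim: r x => [|s r IHr] x.
  rewrite !big_nil; split=> [->|[y _ ->]]; last by rewrite big_nil.
  by exists (fun _ => 0) => //; rewrite big_nil.
move=> /= /andP [sr ur]; rewrite big_cons; split=> [[x0 Xx0 [x1 /(IHr _ ur)]]|].
  case=> [y Xy x1E] <-; exists (fun j => if j == s then x0 else y j).
    move=> j; rewrite inE; case: eqP => [-> //|_ /=]; exact: Xy.
  rewrite big_cons eqxx x1E; congr (_ + _); rewrite !big_seq; apply: eq_bigr => j jr.
  by case: eqP jr sr => // -> ->.
case=> y Xy ->; rewrite big_cons; exists (y s); first by apply: Xy; rewrite inE eqxx.
exists (\sum_(j <- r) y j) => //; apply/IHr => //; exists y => // j jr.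
by apply: Xy; rewrite inE jr orbT.
Qed.

(** * The family of all splits of a configuration *)

Section SplitDecomposition.
Variables (R : realType) (d : nat) (I : finType) (a : I -> 'rV[R]_d).
Hypothesis ha : is_point_configuration a.
Variable h : {set {set I}} -> 'rV[R]_d * R.
Hypothesis hh : is_equation_choice a h.

Local Notation J := (I + {set {set I}})%type.
Local Notation hvec S := (equation_vector (h S)).

(** Both kinds of splits share one index type, so that the results on families treat them
    together. *)
Definition split_weight (j : J) : I -> R :=
  match j with inl p => weight1 R p | inr T => fun k => `|ev a (hvec T) k| end.
Definition split_pairs (j : J) : pred (I * I) :=
  match j with inl p => point_test p | inr T => crossing_test a (hvec T) end.
Definition split_coefs (j : J) : I * I -> R * R :=
  match j with inl p => @point_coef R I | inr T => crossing_coef a (hvec T) end.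
Definition all_splits : {set J} :=
  [set j | match j with inl p => p \in all_1splits a | inr T => T \in all_2splits a end]%SET.

Lemma in_all_splits1 p : (inl p \in all_splits) <-> is_1split_point a p.
Proof. by rewrite inE /= inE; split=> /asboolP. Qed.

Lemma in_all_splits2 S : (inr S \in all_splits) <-> is_2split a S.
Proof. by rewrite inE /= inE; split=> /asboolP. Qed.

Lemma sides_of_2split S : is_2split a S ->
  maximal_faces S = [set pos_side a (hvec S); neg_side a (hvec S)]%SET.
Proof. by move=> S2; apply/induces_2split_sides/hh/two_split_hyperplane. Qed.

Lemma all_splits_tests j : j \in all_splits ->
  split_tests a (split_weight j) (split_pairs j) (split_coefs j).
Proof.
case: j => [p /in_all_splits1|S /in_all_splits2 S2]; first exact: split_tests1.
by apply: (split_tests_sides S2); exact: sides_of_2split.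
Qed.

Lemma all_splits_remove s t u (l : R) :
    s \in all_splits -> t \in all_splits -> s != t -> 0 < l ->
    (forall x ij, envelope a (fun k => u k + l * split_weight t k) x ->
       split_pairs t ij ->
       l * pair_form (split_coefs t ij) ij (split_weight t) <=
       pair_form (split_coefs t ij) ij
         (slack a (fun k => u k + l * split_weight t k) x)) ->
    refines a (split_pairs s) (split_coefs s) (fun k => u k + l * split_weight t k) ->
  refines a (split_pairs s) (split_coefs s) u.
Proof.
case: s t => [p|S] [q|T] sP tP st l0 lef.
- by apply: refines1_remove1 => //; apply: contraNneq st => ->.
- exact: refines1_remove2.
- exact: refines2_remove1.
(* Proportional equations have the same two sides, and the maximal faces determine the 2-split. *)
- apply: refines2_remove2 => // -[r r0 E].
  move/in_all_splits2: sP => S2; move/in_all_splits2: tP => T2; move/eqP: st; apply; congr inr.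
  apply: (eq_maximal_faces_2split S2 T2).
  by rewrite (sides_of_2split S2) (sides_of_2split T2) E sides_scale.
Qed.

Lemma split_primeP w : split_prime a w <->
  forall j, j \in all_splits -> ~ refines a (split_pairs j) (split_coefs j) w.
Proof.
split=> [[p1 p2] [p|S]|prime].
- by move=> /in_all_splits1 /p1 np /coarsens_split1.
- move=> /in_all_splits2 S2 ref; apply: (p2 S S2).
  exact/(coarsens_sides _ (sides_of_2split S2)).
split=> [p sp /coarsens_split1 ref|S S2 /(coarsens_sides _ (sides_of_2split S2)) ref].
  by apply: (prime (inl p)) => //; exact/in_all_splits1.
by apply: (prime (inr S)) => //; exact/in_all_splits2.
Qed.

Definition split_coef (l1 : I -> R) (l2 : {set {set I}} -> R) (j : J) : R :=
  match j with inl p => l1 p | inr T => l2 T end.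

Lemma split_decompositionP w w0 l1 l2 :
  is_split_decomposition a h w w0 l1 l2 <->
  split_prime a w0 /\
  coherent_sum a split_weight w w0 (split_coef l1 l2) all_splits.
Proof.
pose l := split_coef l1 l2.
pose r : seq J := [seq inl p | p <- enum (all_1splits a)] ++ [seq inr T | T <- enum (all_2splits a)].
have ur : uniq r.
  rewrite cat_uniq !map_inj_uniq ?enum_uniq; try by move=> ? ? [].
  by rewrite andbT /=; apply/hasPn => _ /mapP [S _ ->]; apply/mapP => -[].
have rP j : (j \in r) = (j \in all_splits).
  rewrite mem_cat inE; case: j => [p|S] /=.
    rewrite mem_map ?mem_enum; last by move=> ? ? [].
    by rewrite [X in _ || X](_ : _ = false) ?orbF //; apply/negbTE/mapP => -[].
  rewrite orbC mem_map ?mem_enum; last by move=> ? ? [].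
  by rewrite [X in _ || X](_ : _ = false) ?orbF //; apply/negbTE/mapP => -[].
have vsE : [seq (fun i => l1 p * weight1 R p i) | p <- enum (all_1splits a)] ++
    [seq (fun i => l2 T * weight2 a (h T) i) | T <- enum (all_2splits a)] =
    [seq (fun i => l j * split_weight j i) | j <- r].
  rewrite map_cat -!map_comp; congr (_ ++ _); apply: eq_map => T /=.
  by apply/funext => i; rewrite weight2E.
have sumE (V : nmodType) (F : J -> V) : \sum_(j <- r) F j = \sum_(j in all_splits) F j.
  by rewrite big_uniq //; apply: eq_bigl.
have envE x : (minkowski_sum (envelope a w0)
    (\big[@minkowski_sum R (1 + d)/[set 0]]_(j <- r) envelope a (fun i => l j * split_weight j i))) x <->
  exists x0 (y : J -> 'rV[R]_(1 + d)), [/\ envelope a w0 x0,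
    forall j, j \in all_splits -> envelope a (fun k => l j * split_weight j k) (y j)
    & x = x0 + \sum_(j in all_splits) y j].
  split=> [[x0 Ex0 [x1 /in_minkowski_sums [//|y Ey ->] <-]]|[x0 [y [Ex0 Ey ->]]]].
    by exists x0, y; split=> // [j jP|]; [apply: Ey; rewrite rP|rewrite sumE].
  exists x0 => //; exists (\sum_(j in all_splits) y j) => //.
  by apply/in_minkowski_sums => //; exists y => [j|]; rewrite ?rP ?sumE //; apply: Ey.
rewrite /is_split_decomposition /is_coherent_decomposition vsE.
split=> [[l10 l20 prime [wE EE]]|[prime [l0 wE dec]]]; split=> //.
- split.
  + by case=> [p|S]; rewrite inE /=; [exact: l10|exact: l20].
  + by apply/funext => k; rewrite wE big_cons big_map sumE.
  + by move=> x; rewrite -EE big_cons big_map => /envE.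
- by move=> p pP; apply: (l0 (inl p)); rewrite inE.
- by move=> S SP; apply: (l0 (inr S)); rewrite inE.
- split=> [k|]; first by rewrite wE big_cons big_map sumE.
  rewrite big_cons big_map; apply/seteqP; split=> x; last by move=> /dec /envE.
  by move=> /envE [x0 [y [Ex0 Ey ->]]]; rewrite wE; exact: envelope_sum.
Qed.

End SplitDecomposition.

Theorem theorem4p6 (R : realType) (d : nat) (I : finType) (a : I -> 'rV[R]_d)
    (ha : is_point_configuration a)
    (h : {set {set I}} -> 'rV[R]_d * R) (hh : is_equation_choice a h)
    (w : I -> R) :
  exists (w0 : I -> R) (l1 : I -> R) (l2 : {set {set I}} -> R),
    is_split_decomposition a h w w0 l1 l2 /\
    forall (w0' : I -> R) (l1' : I -> R) (l2' : {set {set I}} -> R),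
      is_split_decomposition a h w w0' l1' l2' ->
      [/\ w0' = w0,
          forall p, p \in all_1splits a -> l1' p = l1 p
        & forall S, S \in all_2splits a -> l2' S = l2 S].
Proof.
have st := all_splits_tests hh.
have [w0 [l [dec prime]]] := exists_coherent_sum ha w st.
exists w0, (fun p => l (inl p)), (fun S => l (inr S)).
have lE : split_coef (fun p => l (inl p)) (fun S => l (inr S)) = l.
  by apply/funext => -[].
split; first by apply/split_decompositionP; rewrite lE; split=> //; exact/(split_primeP hh).
move=> w0' l1' l2' /split_decompositionP [/(split_primeP hh) prime' dec'].
have leq : forall j, j \in all_splits a -> split_coef l1' l2' j = l j.
  (* Both first parts are split prime, so the comparison of coefficients holds in either
     direction. *)
  move=> j jP; apply/le_anti/andP; split.
    exact: (coherent_sum_le ha st (all_splits_remove ha hh) dec dec' jP (prime _ jP)).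
  exact: (coherent_sum_le ha st (all_splits_remove ha hh) dec' dec jP (prime' _ jP)).
split.
- have [_ wE _] := dec; have [_ wE' _] := dec'.
  apply/funext => k; have := congr1 (fun u => u k) wE'.
  rewrite {1}wE /add_splits => E; apply: (addIr (\sum_(j in all_splits a) l j * split_weight a h j k)).
  by rewrite E; congr (_ + _); apply: eq_bigr => j /leq ->.
- by move=> p pP; apply: (leq (inl p)); rewrite inE.
- by move=> S SP; apply: (leq (inr S)); rewrite inE.
Qed.
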